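(* For any fixed integer $d\ge 1$, one has $$\lim_{n\to+\infty}\mathring\mu_n(d|d)_d=\frac1d.$$
   Context: A subspace of $\mathbb{R}^n$ is rational if it has a basis of vectors with rational coordinates; $\mathfrak{R}_n(e)$ denotes the set of rational subspaces of $\mathbb{R}^n$ of dimension $e$. A subspace $A$ of $\mathbb{R}^n$ is $(e,j)$-irrational if $\dim(A\cap B)<j$ for all $B\in\mathfrak{R}_n(e)$; $\mathfrak{I}_n(d,e)_j$ denotes the set of all $(e,j)$-irrational subspaces of dimension $d$ of $\mathbb{R}^n$. Height: for $B\in\mathfrak{R}_n(e)$, let $\Xi\in\mathbb{Z}^N$, $N=\binom ne$, be a vector of Pl\''ucker coordinates of $B$ which is integral with setwise coprime coordinates; $H(B)=\Vert\Xi\Vert$ (Euclidean norm). Equivalently $H(B)$ is the covolume of $B\cap\mathbb{Z}^n$ in $B$. Proximity: $\mathbb{R}^n$ has its standard Euclidean structure. For nonzero $X,Y\in\mathbb{R}^n$, $\psi(X,Y)=\Vert X\wedge Y\Vert/(\Vert X\Vert\,\Vert Y\Vert)$ is the sine of the angle between $X$ and $Y$. For subspaces $A,B$ of $\mathbb{R}^n$ of dimensions $d,e\ge 1$ and $t=\min(d,e)$, define inductively $\psi_1(A,B)=\min\{\psi(X,Y): X\in A\setminus\{0\},Y\in B\setminus\{0\}\}$, attained at unit vectors $X_1\in A$, $Y_1\in B$; and, given $(X_1,Y_1),\dots,(X_j,Y_j)$ with $j<t$, let $A_j$ (resp. $B_j$) be the orthogonal complement of $\mathrm{Span}(X_1,\dots,X_j)$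 in $A$ (resp. of $\mathrm{Span}(Y_1,\dots,Y_j)$ in $B$), and $\psi_{j+1}(A,B)=\min\{\psi(X,Y): X\in A_j\setminus\{0\},Y\in B_j\setminus\{0\}\}$, attained at unit vectors $X_{j+1},Y_{j+1}$. (These are the sines of the canonical angles between $A$ and $B$ and do not depend on the choices.) Exponents: let $n\ge 2$, $d,e\in\{1,\dots,n-1\}$ with $d+e\le n$, $j\in\{1,\dots,\min(d,e)\}$. For $A\in\mathfrak{I}_n(d,e)_j$, $\mu_n(A|e)_j\in[0,+\infty]$ is the supremum of all $\beta>0$ such that $\psi_j(A,B)\le H(B)^{-\beta}$ holds for infinitely many $B\in\mathfrak{R}_n(e)$. Set $\mathring\mu_n(d|e)_j=\inf_{A\in\mathfrak{I}_n(d,e)_j}\mu_n(A|e)_j$. *)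

(* Defs.v *)
From HB Require Import structures.
From mathcomp Require Import all_boot all_order all_algebra.
From mathcomp Require Import all_classical all_reals all_analysis.

Set Implicit Arguments.
Unset Strict Implicit.
Unset Printing Implicit Defensive.

Import Order.TTheory GRing.Theory Num.Theory.
Import numFieldNormedType.Exports.

Local Open Scope classical_set_scope.
Local Open Scope ring_scope.

(* Subspaces of R^n are elements of {vspace 'rV[R]_n}, on which Leibniz      *)
(* equality is equality of subspaces.                                        *)

Section Euclidean.
Variables (R : realType) (n : nat).
Implicit Types (X Y : 'rV[R]_n).

Definition dotv X Y : R := \sum_i X 0 i * Y 0 i.

(* The library norm `|X| on 'rV[R]_n is the sup norm. *)
Definition enorm X : R := Num.sqrt (dotv X X).

Definition wedge_norm X Y : R :=
  Num.sqrt (\sum_(i < n) \sum_(k < n | (i < k)%N)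
              (X 0 i * Y 0 k - X 0 k * Y 0 i) ^+ 2).

Definition sin_angle X Y : R := wedge_norm X Y / (enorm X * enorm Y).

End Euclidean.

Section Rational.
Variables (R : realType) (n : nat).
Implicit Types (A B : {vspace 'rV[R]_n}).

Definition is_rational B : Prop :=
  exists2 s : seq 'rV[R]_n, basis_of B s &
    {in s, forall x, exists q : 'rV[rat]_n, x = map_mx ratr q}.

Definition rational_subspaces (e : nat) : set {vspace 'rV[R]_n} :=
  [set B | is_rational B /\ \dim B = e].

Definition is_irrational (e j : nat) A : Prop :=
  forall B, rational_subspaces e B -> (\dim (A :&: B)%VS < j)%N.

Definition irrational_subspaces (d e j : nat) : set {vspace 'rV[R]_n} :=
  [set A | is_irrational e j A /\ \dim A = d].

End Rational.

(* The 'C(n, e) increasing maps from 'I_e to 'I_n index Pluecker coordinates. *)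
Definition plucker_index (e n : nat) :=
  {f : {ffun 'I_e -> 'I_n} |
    [forall i : 'I_e, forall k : 'I_e, (i < k)%N ==> (f i < f k)%N]}.

Section Height.
Variables (R : realType) (n : nat).
Implicit Types (B : {vspace 'rV[R]_n}).

Definition plucker (e : nat) (s : e.-tuple 'rV[R]_n) (f : plucker_index e n) : R :=
  \det (\matrix_(i < e, k < e) (tnth s i) 0 (val f k)).

(* Xi is a vector of Pluecker coordinates of B, integral and setwise coprime. *)
Definition primitive_plucker B (Xi : plucker_index (\dim B) n -> int) : Prop :=
  (exists2 s : (\dim B).-tuple 'rV[R]_n, basis_of B s &
     forall f, plucker s f = (Xi f)%:~R)
  /\ \big[gcdn/0%N]_f `|Xi f|%N = 1%N.

(* For rational B, Xi exists and is unique up to sign, so that the set below *)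
(* is a singleton.                                                           *)
Definition height B : R :=
  xget 0 [set h | exists2 Xi, primitive_plucker (B := B) Xi &
                    h = Num.sqrt (\sum_f (Xi f)%:~R ^+ 2)].

End Height.

Section Proximity.
Variables (R : realType) (n : nat).
Implicit Types (A B : {vspace 'rV[R]_n}).

Definition orth_in A (s : seq 'rV[R]_n) : set 'rV[R]_n :=
  [set X | X \in A /\ forall Y, Y \in span s -> dotv X Y = 0].

(* The pairs (X 0, Y 0), ..., (X j.-1, Y j.-1) are obtained by the first j   *)
(* steps of the inductive construction of the canonical angles of A and B.   *)
Definition canonical_pairs A B (j : nat) (X Y : nat -> 'rV[R]_n) : Prop :=
  forall i, (i < j)%N ->
    let Ai := orth_in A (mkseq X i) in
    let Bi := orth_in B (mkseq Y i) in
    [/\ Ai (X i) /\ enorm (X i) = 1,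
        Bi (Y i) /\ enorm (Y i) = 1 &
        forall X' Y', Ai X' -> X' != 0 -> Bi Y' -> Y' != 0 ->
          sin_angle (X i) (Y i) <= sin_angle X' Y'].

(* psi j is the j-th proximity, counted from 1.  For                         *)
(* 1 <= j <= min (\dim A) (\dim B) the set below is a singleton, since the   *)
(* canonical angles do not depend on the choice of the minimizing pairs.     *)
Definition psi (j : nat) A B : R :=
  xget 0 [set s | exists X Y, canonical_pairs A B j X Y /\
                    s = sin_angle (X j.-1) (Y j.-1)].

End Proximity.

Section Exponents.
Variables (R : realType) (n : nat).

(* 0 is added because the supremum is taken in [0, +oo]: that of the empty   *)
(* set is 0, whereas ereal_sup set0 = -oo.                                   *)
Definition mu (A : {vspace 'rV[R]_n}) (e j : nat) : \bar R :=
  ereal_sup (0%E |` [set beta%:E | beta in [set beta : R | 0 < beta /\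
    infinite_set [set B | rational_subspaces e B /\
                          psi j A B <= height B `^ (- beta)]]]).

End Exponents.

Definition mu_circ (R : realType) (n d e j : nat) : \bar R :=
  ereal_inf [set mu A e j | A in @irrational_subspaces R n d e j].

(* Main.v *)
Require Import Defs.
From HB Require Import structures.
From mathcomp Require Import all_boot all_order all_algebra.
From mathcomp Require Import all_classical all_reals all_analysis.
From mathcomp Require Import perm ring lra zify.
Import Order.TTheory GRing.Theory Num.Theory.
Import numFieldNormedType.Exports.
Local Open Scope classical_set_scope.
Local Open Scope ring_scope.

Set Implicit Arguments.
Unset Strict Implicit.
Unset Printing Implicit Defensive.

(* For n > d one has 1/d <= mu_circ n d d d <= n / (d (n - d)).

   Lower bound: let M be a basis of A, the subspace B_q spanned by the integral
   parts of the rows of q M has height O(q^d) and lies at distance O(1/q) from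
   A, so every exponent less than 1/d is reached; the B_q are infinitely many
   since they converge to A, which is not rational.

   Upper bound: let al_k be the roots of a totally real irreducible monic
   integral polynomial of degree n, and let A be the space of the x with
   P_x(al_k) = 0 for k >= d, where P_x = sum_i x_i X^i. For x integral and
   nonzero, prod_k P_x(al_k) is a nonzero integer, whence
   1 <= C |x|^d |x - a|^(n - d) for all a in A. A rational B contains an integral
   x with |x| = O(H(B)^(1/d)) by Minkowski's theorem, and such an x is at
   distance at most d psi |x| from A. Thus psi_d(A, B) <= H(B)^(-b) with
   b > n / (d (n - d)) bounds H(B), and Northcott's theorem concludes. *)

(** * Euclidean geometry *)

Section EuclideanFacts.
Context {R : realType} {n : nat}.
Implicit Types (X Y Z : 'rV[R]_n) (c : R).

Lemma dotvC X Y : dotv X Y = dotv Y X.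
Proof. by apply: eq_bigr => i _; rewrite mulrC. Qed.

Lemma dotvDl X Y Z : dotv (X + Y) Z = dotv X Z + dotv Y Z.
Proof. by rewrite -big_split; apply: eq_bigr => i _; rewrite mxE mulrDl. Qed.

Lemma dotvZl c X Y : dotv (c *: X) Y = c * dotv X Y.
Proof. by rewrite mulr_sumr; apply: eq_bigr => i _; rewrite mxE mulrA. Qed.

Lemma dotvDr X Y Z : dotv Z (X + Y) = dotv Z X + dotv Z Y.
Proof. by rewrite dotvC dotvDl !(dotvC Z). Qed.

Lemma dotvZr c X Y : dotv Y (c *: X) = c * dotv Y X.
Proof. by rewrite dotvC dotvZl (dotvC Y). Qed.

Lemma dotvNl X Y : dotv (- X) Y = - dotv X Y.
Proof. by rewrite -scaleN1r dotvZl mulN1r. Qed.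

Lemma dotvNr X Y : dotv Y (- X) = - dotv Y X.
Proof. by rewrite dotvC dotvNl (dotvC Y). Qed.

Definition dotvE := (dotvDl, dotvDr, dotvZl, dotvZr, dotvNl, dotvNr).

Lemma dot0v X : dotv 0 X = 0.
Proof. by rewrite -(scale0r 0) dotvZl mul0r. Qed.

Lemma dotv_suml (I : Type) (r : seq I) (P : pred I) (F : I -> 'rV[R]_n) X :
  dotv (\sum_(i <- r | P i) F i) X = \sum_(i <- r | P i) dotv (F i) X.
Proof. by elim/big_rec2: _ => [|i y1 y2 _ <-]; rewrite ?dot0v ?dotvDl. Qed.

Lemma dotv_ge0 X : 0 <= dotv X X.
Proof. by apply: sumr_ge0 => i _; rewrite -expr2 sqr_ge0. Qed.

Lemma dotv_eq0 X : (dotv X X == 0) = (X == 0).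
Proof.
apply/eqP/eqP => [X0|->]; last by rewrite dot0v.
apply/rowP => i; rewrite mxE; apply/eqP; rewrite -sqrf_eq0 expr2.
by move/psumr_eq0P: X0 => ->// k _; rewrite -expr2 sqr_ge0.
Qed.

Lemma enorm_ge0 X : 0 <= enorm X.
Proof. exact: sqrtr_ge0. Qed.

Lemma sqr_enorm X : enorm X ^+ 2 = dotv X X.
Proof. by rewrite sqr_sqrtr// dotv_ge0. Qed.

Lemma enorm_eq0 X : (enorm X == 0) = (X == 0).
Proof. by rewrite -sqrf_eq0 sqr_enorm dotv_eq0. Qed.

Lemma enorm_gt0 X : (0 < enorm X) = (X != 0).
Proof. by rewrite lt_def enorm_eq0 enorm_ge0 andbT. Qed.

Lemma enorm0 : enorm (0 : 'rV[R]_n) = 0.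
Proof. by apply/eqP; rewrite enorm_eq0. Qed.

Lemma enormZ c X : enorm (c *: X) = `|c| * enorm X.
Proof.
by rewrite /enorm dotvZl dotvZr mulrA -expr2 sqrtrM ?sqr_ge0// sqrtr_sqr.
Qed.

Lemma enormN X : enorm (- X) = enorm X.
Proof. by rewrite -scaleN1r enormZ normrN1 mul1r. Qed.

Lemma enorm_normalize X : X != 0 -> enorm ((enorm X)^-1 *: X) = 1.
Proof.
move=> X0; rewrite enormZ ger0_norm ?invr_ge0 ?enorm_ge0// mulVf//.
by rewrite enorm_eq0.
Qed.

Lemma wedge_norm_ge0 X Y : 0 <= wedge_norm X Y.
Proof. exact: sqrtr_ge0. Qed.

(** Lagrange's identity. The summand is symmetric in [i] and [k] and vanishes on the diagonal, so
    the sum over [i < k] is half of the full double sum, which expands into products of single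
    sums. *)
Lemma sqr_wedge_norm X Y :
  wedge_norm X Y ^+ 2 = dotv X X * dotv Y Y - dotv X Y ^+ 2.
Proof.
rewrite sqr_sqrtr; last first.
  by apply: sumr_ge0 => i _; apply: sumr_ge0 => k _; rewrite sqr_ge0.
pose F i k := (X 0 i * Y 0 k - X 0 k * Y 0 i) ^+ 2.
have FC i k : F i k = F k i by rewrite /F; ring.
have F0 i : F i i = 0 by rewrite /F; ring.
have H2 : \sum_i \sum_k F i k = (\sum_(i < n) \sum_(k < n | (i < k)%N) F i k) *+ 2.
  have -> : \sum_i \sum_k F i k =
    \sum_(i < n) (\sum_(k < n | (i < k)%N) F i k + \sum_(k < n | (k < i)%N) F i k).
    apply: eq_bigr => i _; rewrite (bigID (fun k : 'I_n => (i < k)%N)) /=.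
    congr (_ + _); rewrite (bigD1 i) ?ltnn //= F0 add0r; apply: eq_bigl => k.
    by rewrite -leqNgt ltn_neqAle andbC.
  rewrite big_split mulr2n; congr (_ + _).
  rewrite (exchange_big_dep predT) //=; apply: eq_bigr => i _.
  by apply: eq_bigr => k _; rewrite FC.
apply/eqP; rewrite -(eqr_pMn2r (_ : 0 < 2)%N) //; apply/eqP; rewrite -H2.
have -> : \sum_i \sum_k F i k =
  \sum_i \sum_k ((X 0 i * X 0 i) * (Y 0 k * Y 0 k) +
    (Y 0 i * Y 0 i) * (X 0 k * X 0 k) -
    ((X 0 i * Y 0 i) * (X 0 k * Y 0 k)) *+ 2).
  by apply: eq_bigr => i _; apply: eq_bigr => k _; rewrite /F; ring.
under eq_bigr do rewrite sumrB big_split /= sumrMnl -!mulr_sumr.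
rewrite sumrB big_split /= sumrMnl -!mulr_suml.
by rewrite /dotv; ring.
Qed.

Lemma dotv_sqr_le X Y : dotv X Y ^+ 2 <= dotv X X * dotv Y Y.
Proof. by rewrite -subr_ge0 -sqr_wedge_norm sqr_ge0. Qed.

Lemma norm_dotv_le X Y : `|dotv X Y| <= enorm X * enorm Y.
Proof.
rewrite -(@ler_pXn2r _ 2) ?nnegrE ?mulr_ge0 ?enorm_ge0//.
by rewrite real_normK ?num_real// exprMn !sqr_enorm dotv_sqr_le.
Qed.

Lemma enormD X Y : enorm (X + Y) <= enorm X + enorm Y.
Proof.
rewrite -(@ler_pXn2r _ 2) ?nnegrE ?addr_ge0 ?enorm_ge0//.
rewrite sqrrD !sqr_enorm !dotvE (dotvC Y X).
have := le_trans (ler_norm _) (norm_dotv_le X Y); rewrite mulr2n; lra.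
Qed.

Lemma enormB X Y : enorm (X - Y) <= enorm X + enorm Y.
Proof. by rewrite -(enormN Y) enormD. Qed.

Lemma enorm_sum (I : Type) (r : seq I) (P : pred I) (F : I -> 'rV[R]_n) :
  enorm (\sum_(i <- r | P i) F i) <= \sum_(i <- r | P i) enorm (F i).
Proof.
elim/big_rec2: _ => [|i y1 y2 _ le12]; first by rewrite enorm0.
by rewrite (le_trans (enormD _ _))// lerD2l.
Qed.

Lemma coord_le_enorm X i : `|X 0 i| <= enorm X.
Proof.
rewrite -(@ler_pXn2r _ 2) ?nnegrE ?enorm_ge0//.
rewrite real_normK ?num_real// sqr_enorm /dotv (bigD1 i) //= -expr2 lerDl.
by apply: sumr_ge0 => k _; rewrite -expr2 sqr_ge0.
Qed.

Lemma enorm_le X c : (forall i, `|X 0 i| <= c) -> enorm X <= n%:R * c.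
Proof.
move=> Xc; case: (posnP n) => [n0|n_gt0].
  suff -> : X = 0 by rewrite enorm0 n0 mul0r.
  by apply/rowP => i; have := ltn_ord i; rewrite {2}n0.
have c0 : 0 <= c := le_trans (normr_ge0 _) (Xc (Ordinal n_gt0)).
rewrite -(@ler_pXn2r _ 2) ?nnegrE ?enorm_ge0 ?mulr_ge0// sqr_enorm.
apply: (@le_trans _ _ (\sum_(i < n) c ^+ 2)).
  apply: ler_sum => i _; rewrite -expr2 -(real_normK (num_real _)).
  by rewrite ler_pXn2r ?nnegrE.
rewrite sumr_const card_ord exprMn -[leLHS]mulr_natl ler_wpM2r ?sqr_ge0//.
by rewrite -natrX ler_nat -mulnn leq_pmulr.
Qed.

Lemma sin_angleZl c X Y : c != 0 -> sin_angle (c *: X) Y = sin_angle X Y.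
Proof.
move=> c0; rewrite /sin_angle enormZ.
have -> : wedge_norm (c *: X) Y = `|c| * wedge_norm X Y.
  apply/eqP; rewrite -(@eqrXn2 _ 2) ?mulr_ge0 ?wedge_norm_ge0//.
  rewrite exprMn real_normK ?num_real// !sqr_wedge_norm !dotvE; apply/eqP; ring.
by rewrite -[_ * _ * enorm Y]mulrA -mulf_div divff ?mul1r// normr_eq0.
Qed.

Lemma sin_angleC X Y : sin_angle X Y = sin_angle Y X.
Proof.
rewrite /sin_angle [enorm X * _]mulrC; congr (_ / _).
apply/eqP; rewrite -(@eqrXn2 _ 2) ?wedge_norm_ge0//.
by rewrite !sqr_wedge_norm (dotvC X Y) mulrC.
Qed.

Lemma sin_angleZr c X Y : c != 0 -> sin_angle X (c *: Y) = sin_angle X Y.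
Proof. by move=> c0; rewrite sin_angleC sin_angleZl// sin_angleC. Qed.

Lemma sin_angle_ge0 X Y : 0 <= sin_angle X Y.
Proof. by rewrite divr_ge0 ?mulr_ge0 ?enorm_ge0 ?wedge_norm_ge0. Qed.

(** Pythagoras: both squares equal [1 - dotv X Y ^+ 2]. This turns angles into distances. *)
Lemma enorm_sub_proj X Y : enorm X = 1 -> enorm Y = 1 ->
  enorm (Y - dotv X Y *: X) = sin_angle X Y.
Proof.
move=> X1 Y1; rewrite /sin_angle X1 Y1 !mulr1 divr1.
apply/eqP; rewrite -(@eqrXn2 _ 2) ?wedge_norm_ge0 ?enorm_ge0//.
rewrite sqr_wedge_norm sqr_enorm !dotvE -!sqr_enorm X1 Y1 (dotvC Y X).
by apply/eqP; ring.
Qed.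

(** The sine is the distance from [Y] to the line of [X], hence at most the distance to [X] itself,
    whatever the length of [X]. *)
Lemma sin_angle_le_dist X Y : X != 0 -> enorm Y = 1 ->
  sin_angle X Y <= enorm (Y - X).
Proof.
move=> X0 Y1; rewrite /sin_angle Y1 mulr1 ler_pdivrMr ?enorm_gt0//.
rewrite -(@ler_pXn2r _ 2) ?nnegrE ?mulr_ge0 ?enorm_ge0 ?wedge_norm_ge0//.
rewrite exprMn sqr_wedge_norm !sqr_enorm !dotvE -(sqr_enorm Y) Y1 (dotvC Y X).
rewrite -subr_ge0; set a := dotv X X; set b := dotv X Y.
by rewrite (_ : _ - _ = (a - b) ^+ 2) ?sqr_ge0//; ring.
Qed.

End EuclideanFacts.

(** * Row spans and orthonormal systems *)

Section RowSpans.
Context {F : fieldType} {n : nat}.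

(** Subspaces are handled as row spaces, which gives access to ranks, cokernels and minors. *)
Definition mxspan m (M : 'M[F]_(m, n)) : {vspace 'rV[F]_n} :=
  <<[tuple row i M | i < m]>>%VS.

Lemma mem_mxspan m (M : 'M[F]_(m, n)) x : (x \in mxspan M) = (x <= M)%MS.
Proof.
apply/idP/idP => [/coord_span ->|/submxP[c ->]].
  apply: summx_sub => i _; apply: scalemx_sub.
  by rewrite -tnth_nth tnth_mktuple row_sub.
rewrite mulmx_sum_row; apply: memv_suml => i _; apply: memvZ.
by apply: memv_span; apply/tnthP; exists i; rewrite tnth_mktuple.
Qed.

Lemma mxspan_basis m (M : 'M[F]_(m, n)) : row_free M ->
  basis_of (mxspan M) [tuple row i M | i < m].
Proof.
move=> Mfree; rewrite /basis_of eqxx /=; apply/(@freeP _ _ m [tuple row i M | i < m]) => k k0 i.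
have : (\row_i k i) *m M = 0.
  rewrite mulmx_sum_row -{}[RHS]k0; apply: eq_bigr => j _.
  by rewrite mxE -tnth_nth tnth_mktuple.
by move/eqP; rewrite mulmx_free_eq0// => /eqP/rowP/(_ i); rewrite !mxE.
Qed.

Lemma dim_mxspan m (M : 'M[F]_(m, n)) : row_free M -> \dim (mxspan M) = m.
Proof. by move=> /mxspan_basis/size_basis. Qed.

Definition tuple_mx m (s : m.-tuple 'rV[F]_n) : 'M[F]_(m, n) :=
  \matrix_i tnth s i.

Lemma mxspan_tuple_mx m (s : m.-tuple 'rV[F]_n) :
  mxspan (tuple_mx s) = span s.
Proof.
congr (span (tval _)); apply: eq_from_tnth => i.
by rewrite tnth_mktuple rowK.
Qed.

Lemma free_tuple_mx m (s : m.-tuple 'rV[F]_n) : free s -> row_free (tuple_mx s).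
Proof.
move=> /freeP sfree; rewrite -kermx_eq0; apply/rowV0P => c /sub_kermxP.
rewrite mulmx_sum_row => c0; apply/rowP => i; rewrite mxE.
by apply: sfree; rewrite -[RHS]c0; apply: eq_bigr => j _; rewrite rowK -tnth_nth.
Qed.

Lemma basis_tuple_mx m (A : {vspace 'rV[F]_n}) (s : m.-tuple 'rV[F]_n) :
  basis_of A s -> row_free (tuple_mx s) /\ A = mxspan (tuple_mx s).
Proof.
move=> /andP[/eqP sA sfree]; rewrite mxspan_tuple_mx sA.
by split=> //; exact: free_tuple_mx.
Qed.

Lemma vspace_mxspan (A : {vspace 'rV[F]_n}) :
  exists2 M : 'M[F]_(\dim A, n), row_free M & A = mxspan M.
Proof.
by have [? ?] := basis_tuple_mx (vbasisP A); exists (tuple_mx (vbasis A)).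
Qed.

Lemma eq_mxspan m1 m2 (M1 : 'M[F]_(m1, n)) (M2 : 'M[F]_(m2, n)) :
  (M1 :=: M2)%MS -> mxspan M1 = mxspan M2.
Proof. by move=> eqM; apply/vspaceP => x; rewrite !mem_mxspan eqM. Qed.

Lemma mxspan_full m (A : {vspace 'rV[F]_n}) (M : 'M[F]_(m, n)) :
  row_free M -> (forall i, row i M \in A) -> \dim A = m -> A = mxspan M.
Proof.
move=> Mfree MA dA; apply/esym/eqP; rewrite eqEdim dA dim_mxspan// leqnn andbT.
by apply/span_subvP => x /tnthP[i ->]; rewrite tnth_mktuple.
Qed.

End RowSpans.

Section OrthonormalSystems.
Context {R : realType} {n : nat}.
Implicit Types (A B : {vspace 'rV[R]_n}) (X Y : nat -> 'rV[R]_n).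

(** The shape matches the orthogonality and unit conditions that [canonical_pairs] puts on each of
    its two families. *)
Definition orthonormal_in A j X := forall i, (i < j)%N ->
  orth_in A (mkseq X i) (X i) /\ enorm (X i) = 1.

Lemma orth_inP A X i Z : orth_in A (mkseq X i) Z <->
  Z \in A /\ forall k, (k < i)%N -> dotv Z (X k) = 0.
Proof.
split=> -[ZA Zorth]; split=> //.
  by move=> k ki; apply: Zorth; apply: memv_span; apply/mapP; exists k; rewrite ?mem_iota.
move=> Y /(@coord_span _ _ _ (in_tuple (mkseq X i))) ->; rewrite dotvC dotv_suml big1// => k _.
have ki : (k < i)%N by case: k => k /=; rewrite size_mkseq.
by rewrite dotvZl nth_mkseq// dotvC Zorth ?mulr0.
Qed.

Lemma orth_in_le A X i j Z : (i <= j)%N ->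
  orth_in A (mkseq X j) Z -> orth_in A (mkseq X i) Z.
Proof.
move=> ij /orth_inP[ZA Zj]; apply/orth_inP; split=> // k ki.
exact/Zj/(leq_trans ki).
Qed.

Lemma orthonormal_dotv A j X i k : orthonormal_in A j X ->
  (i < j)%N -> (k < j)%N -> dotv (X i) (X k) = (i == k)%:R.
Proof.
move=> onX ij kj; case: (ltngtP i k) => [ik|ki|->]; last first.
- by have [_ Xk] := onX _ kj; rewrite -sqr_enorm Xk expr1n.
- by have [/orth_inP[_ ->]] := onX _ ij.
- by have [/orth_inP[_ ik0] _] := onX _ kj; rewrite dotvC ik0.
Qed.

Lemma orthonormal_mem A j X i : orthonormal_in A j X -> (i < j)%N -> X i \in A.
Proof. by move=> onX /onX[/orth_inP[]]. Qed.

(** The Gram-Schmidt step. It serves to extend orthonormal systems and, in [psi_le], to make a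
    vector admissible. *)
Lemma orthonormal_residual A j X Z : orthonormal_in A j X -> Z \in A ->
  orth_in A (mkseq X j) (Z - \sum_(k < j) dotv Z (X k) *: X k).
Proof.
move=> onX ZA; apply/orth_inP; split.
  by apply: memvB => //; apply: memv_suml => k _; apply/memvZ/(orthonormal_mem onX).
move=> k kj; rewrite !dotvE dotv_suml (bigD1 (Ordinal kj))//= big1 => [|i ik].
  by rewrite dotvZl (orthonormal_dotv onX)// eqxx /= mulr1 addr0 subrr.
rewrite dotvZl (orthonormal_dotv onX)//.
by rewrite -val_eqE /= in ik; rewrite (negPf ik) mulr0.
Qed.

Lemma orthonormal_extend A j X : orthonormal_in A j X -> (j < \dim A)%N ->
  exists2 Z, Z != 0 & orth_in A (mkseq X j) Z.
Proof.
move=> onX jA; have : ~~ (A <= <<mkseq X j>>)%VS.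
  apply/negP => /dimvS; apply/negP; rewrite -ltnNge; apply: leq_ltn_trans jA.
  by rewrite (leq_trans (dim_span _))// size_mkseq.
move=> /subvPn[Z ZA ZX]; eexists; last exact: orthonormal_residual onX ZA.
apply: contraNneq ZX => /eqP; rewrite subr_eq0 => /eqP ->.
apply: memv_suml => k _; apply/memvZ/memv_span/mapP.
by exists (k : nat); rewrite ?mem_iota/=.
Qed.

Lemma orthonormal_decomp A X Z : orthonormal_in A (\dim A) X -> Z \in A ->
  Z = \sum_(k < \dim A) dotv Z (X k) *: X k.
Proof.
move=> onX ZA; pose t := [tuple X k | k < \dim A].
have tX (k : 'I_(\dim A)) : t`_k = X k by rewrite -tnth_nth tnth_mktuple.
have dott (c : 'I_(\dim A) -> R) (i : 'I_(\dim A)) :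
    dotv (\sum_(k < \dim A) c k *: t`_k) (X i) = c i.
  rewrite dotv_suml (bigD1 i)//= tX dotvZl (orthonormal_dotv onX)//.
  rewrite eqxx mulr1 big1 ?addr0// => k ki.
  rewrite tX dotvZl (orthonormal_dotv onX)//.
  by rewrite -val_eqE /= in ki; rewrite (negPf ki) mulr0.
have tA : basis_of A t.
  rewrite basisEfree size_tuple leqnn andbT; apply/andP; split.
    by apply/(@freeP _ _ _ t) => c c0 i; rewrite -(dott c i) c0 dot0v.
  apply/span_subvP => x /tnthP[i ->]; rewrite tnth_mktuple.
  exact: (orthonormal_mem onX).
rewrite {1}(coord_basis tA ZA); apply: eq_bigr => k _; rewrite tX; congr (_ *: _).
by rewrite {2}(coord_basis tA ZA) (dott (fun k => coord t k Z)).
Qed.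

End OrthonormalSystems.

(** * Canonical angles *)

Section CanonicalPairs.
Context {R : realType} {n : nat}.
Implicit Types (A B : {vspace 'rV[R]_n}) (X Y : nat -> 'rV[R]_n).

Lemma continuous_bigsum (T : topologicalType) (I : Type) (r : seq I)
    (F : I -> T -> R) : (forall i, continuous (F i)) ->
  continuous (fun v => \sum_(i <- r) F i v).
Proof.
move=> cF; elim: r => [|i r IHr] v.
  under eq_fun do rewrite big_nil; exact: cst_continuous.
under eq_fun do rewrite big_cons; apply: continuousD; [exact: cF|exact: IHr].
Qed.

Lemma continuous_dotv (T : topologicalType) (f g : T -> 'rV[R]_n) :
  (forall i, continuous (fun v => f v 0 i)) ->
  (forall i, continuous (fun v => g v 0 i)) ->
  continuous (fun v => dotv (f v) (g v)).
Proof.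
move=> cf cg; apply: continuous_bigsum => i v.
by apply: continuousM; [exact: cf|exact: cg].
Qed.

Lemma closed_fiber (T : topologicalType) (f : T -> R) (c : R) :
  continuous f -> closed [set v | f v = c].
Proof. by move=> /continuous_closedP/(_ _ (@closed_eq _ c)). Qed.

(** Membership in [A] is the vanishing of the linear forms given by the columns of [cokermx M], so
    every condition is a fiber of a continuous function. The map [f] is meant to be a projection
    from pairs of vectors. *)
Lemma closed_orth_in (T : topologicalType) (f : T -> 'rV[R]_n) A X j :
  (forall i, continuous (fun v => f v 0 i)) ->
  closed [set v | orth_in A (mkseq X j) (f v)].
Proof.
move=> cf; have [M _ AM] := vspace_mxspan A.
rewrite (_ : [set _ | _] =
  (\bigcap_(i in [set: 'I_n]) [set v | (f v *m cokermx M) 0 i = 0]) `&`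
  (\bigcap_(k in [set k | (k < j)%N]) [set v | dotv (f v) (X k) = 0])).
  apply: closedI; apply: closed_bigI => i _; apply: closed_fiber.
    under eq_fun do rewrite mxE; apply: continuous_bigsum => k v.
    by apply: continuousM; [exact: cf|exact: cst_continuous].
  by apply: continuous_dotv => // k; exact: cst_continuous.
have memA v : f v \in A <-> f v *m cokermx M = 0.
  by rewrite [in f v \in A]AM mem_mxspan submxE; split=> /eqP.
apply/seteqP; split=> v /=.
  by move=> /orth_inP[/memA fA fX]; split=> // i _ /=; rewrite fA mxE.
move=> [fA fX]; apply/orth_inP; split=> //; apply/memA.
by apply/rowP => i; rewrite [RHS]mxE; exact: (fA i I).
Qed.

(** By compactness. For unit vectors the squared sine is [1 - dotv x y ^+ 2], so maximizing the
    squared product minimizes the angle. *)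
Lemma max_dotv_pair A B X Y j : orthonormal_in A j X -> orthonormal_in B j Y ->
  (j < \dim A)%N -> (j < \dim B)%N ->
  exists x y, [/\ orth_in A (mkseq X j) x /\ enorm x = 1,
    orth_in B (mkseq Y j) y /\ enorm y = 1 &
    forall x' y', orth_in A (mkseq X j) x' -> enorm x' = 1 ->
      orth_in B (mkseq Y j) y' -> enorm y' = 1 ->
      dotv x' y' ^+ 2 <= dotv x y ^+ 2].
Proof.
move=> onX onY jA jB.
have unit_ex (C : {vspace 'rV[R]_n}) Z : orthonormal_in C j Z ->
    (j < \dim C)%N -> exists2 z, orth_in C (mkseq Z j) z & enorm z = 1.
  move=> onZ jC; have [z z0 zC] := orthonormal_extend onZ jC.
  exists ((enorm z)^-1 *: z); last exact: enorm_normalize.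
  have /orth_inP[z1 z2] := zC; apply/orth_inP; split; first exact: memvZ.
  by move=> k kj; rewrite dotvZl z2// mulr0.
have [x0 x0A x01] := unit_ex _ _ onX jA; have [y0 y0B y01] := unit_ex _ _ onY jB.
(* A pair of vectors is packed into one row of length [n + n], to which the extreme value theorem
   applies. *)
pose l (v : 'rV[R]_(n + n)) : 'rV[R]_n := lsubmx v.
pose r (v : 'rV[R]_(n + n)) : 'rV[R]_n := rsubmx v.
have cl i : continuous (fun v => l v 0 i).
  by under eq_fun do rewrite mxE; exact: coord_continuous.
have cr i : continuous (fun v => r v 0 i).
  by under eq_fun do rewrite mxE; exact: coord_continuous.
pose K := [set v | orth_in A (mkseq X j) (l v)] `&` [set v | dotv (l v) (l v) = 1]
  `&` ([set v | orth_in B (mkseq Y j) (r v)] `&` [set v | dotv (r v) (r v) = 1]).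
have norm1 (z : 'rV[R]_n) : dotv z z = 1 <-> enorm z = 1.
  split=> [z1|z1]; first by rewrite /enorm z1 sqrtr1.
  by rewrite -sqr_enorm z1 expr1n.
have Kne : K !=set0.
  exists (row_mx x0 y0); rewrite /K /l /r /= row_mxKl row_mxKr.
  by split; split=> //; exact/norm1.
have Kc : compact K.
  apply: bounded_closed_compact.
    exists 1; split; rewrite ?num_real// => M M1 v [[_ /norm1 l1] [_ /norm1 r1]].
    rewrite /= [leLHS]/Num.norm /= mx_normrE; apply/bigmax_leP; split=> [|[i k] _ /=].
      by rewrite (le_trans _ (ltW M1)).
    rewrite ord1 -[v]hsubmxK; apply: le_trans (ltW M1).
    case: (splitP k) => k' kE.
      rewrite (_ : k = lshift n k'); last exact: val_inj.
      by rewrite row_mxEl -l1 coord_le_enorm.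
    rewrite (_ : k = rshift n k'); last exact: val_inj.
    by rewrite row_mxEr -r1 coord_le_enorm.
  by apply: closedI; apply: closedI; (apply: closed_orth_in => //) ||
    (apply: closed_fiber; exact: continuous_dotv).
have cdot : continuous (fun v => dotv (l v) (r v) ^+ 2).
  have cd : continuous (fun v => dotv (l v) (r v)) by exact: continuous_dotv.
  by move=> v; exact: (continuousM (cd v) (cd v)).
have [v vK vmax] := EVT_max_rV Kne Kc (continuous_subspaceT cdot).
move: vK; rewrite inE => -[[lA /norm1 l1] [rB /norm1 r1]].
exists (l v), (r v); split=> // x' y' x'A x'1 y'B y'1.
have := vmax (row_mx x' y'); rewrite /l /r row_mxKl row_mxKr; apply.
by rewrite inE /K /l /r /= row_mxKl row_mxKr; split; split=> //; exact/norm1.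
Qed.

Lemma canonical_pairs_orthonormal A B X Y j : canonical_pairs A B j X Y ->
  orthonormal_in A j X /\ orthonormal_in B j Y.
Proof. by move=> cXY; split=> i /cXY[]. Qed.

Lemma canonical_pairs_exist A B j : (j <= \dim A)%N -> (j <= \dim B)%N ->
  exists X Y, canonical_pairs A B j X Y.
Proof.
elim: j => [|j IHj] jA jB; first by exists (fun=> 0), (fun=> 0).
have [X [Y cXY]] := IHj (ltnW jA) (ltnW jB).
have [onX onY] := canonical_pairs_orthonormal cXY.
have [x [y [[xA x1] [yB y1] xymax]]] := max_dotv_pair onX onY jA jB.
(* The new pair is placed at index [j]; the families are unchanged below [j], so the earlier
   conditions persist. *)
pose X' i := if (i < j)%N then X i else x; pose Y' i := if (i < j)%N then Y i else y.
have mkX i : (i <= j)%N -> mkseq X' i = mkseq X i.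
  move=> ij; apply: (@eq_from_nth _ 0); rewrite !size_mkseq// => k ki.
  by rewrite !nth_mkseq// /X' (leq_trans ki ij).
have mkY i : (i <= j)%N -> mkseq Y' i = mkseq Y i.
  move=> ij; apply: (@eq_from_nth _ 0); rewrite !size_mkseq// => k ki.
  by rewrite !nth_mkseq// /Y' (leq_trans ki ij).
exists X', Y' => i; rewrite ltnS => ij /=; rewrite mkX// mkY//.
move: ij; rewrite leq_eqVlt => /orP[/eqP ->|ij]; last first.
  by rewrite /X' /Y' ij; exact: cXY.
rewrite /X' /Y' ltnn; split=> // u v uA u0 vB v0.
pose u1 := (enorm u)^-1 *: u; pose v1 := (enorm v)^-1 *: v.
have -> : sin_angle u v = sin_angle u1 v1.
  by rewrite sin_angleZl ?sin_angleZr// invr_neq0// enorm_eq0.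
have n1 : enorm u1 = 1 by exact: enorm_normalize.
have n2 : enorm v1 = 1 by exact: enorm_normalize.
have u1A : orth_in A (mkseq X j) u1.
  have /orth_inP[? uX] := uA; apply/orth_inP; split; first exact: memvZ.
  by move=> k kj; rewrite dotvZl uX// mulr0.
have v1B : orth_in B (mkseq Y j) v1.
  have /orth_inP[? vY] := vB; apply/orth_inP; split; first exact: memvZ.
  by move=> k kj; rewrite dotvZl vY// mulr0.
rewrite /sin_angle n1 n2 x1 y1 !mulr1 !divr1.
rewrite -(@ler_pXn2r _ 2) ?nnegrE ?wedge_norm_ge0// !sqr_wedge_norm.
rewrite -!sqr_enorm n1 n2 x1 y1 lerD2l lerN2.
exact: xymax.
Qed.

(** The existence of canonical pairs rules out the default value 0 of [xget]. *)
Lemma psi_canonical A B j : (j <= \dim A)%N -> (j <= \dim B)%N ->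
  exists X Y, canonical_pairs A B j X Y /\
    psi j A B = sin_angle (X j.-1) (Y j.-1).
Proof.
move=> jA jB; rewrite /psi; case: xgetP => [s _ [X [Y [cXY sE]]]|none].
  by exists X, Y.
have [X [Y cXY]] := canonical_pairs_exist jA jB.
by case: (none (sin_angle (X j.-1) (Y j.-1))); exists X, Y.
Qed.

(** The sets over which the minimum is taken shrink from one step to the next, so the last sine
    bounds all the others. *)
Lemma canonical_pairs_mono A B X Y j i : canonical_pairs A B j X Y ->
  (i < j)%N -> sin_angle (X i) (Y i) <= sin_angle (X j.-1) (Y j.-1).
Proof.
move=> cXY ij; have j1 : (j.-1 < j)%N by rewrite prednK// (leq_ltn_trans _ ij).
have [_ _] := cXY _ ij; have [[XA X1] [YB Y1] _] := cXY _ j1.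
have ij1 : (i <= j.-1)%N by rewrite -ltnS prednK// (leq_ltn_trans _ ij).
apply; rewrite -?enorm_gt0 ?X1 ?Y1//; exact: orth_in_le ij1 _.
Qed.

Lemma psi_ge0 A B j : 0 <= psi j A B.
Proof.
rewrite /psi; case: xgetP => [s _ [X [Y [_ ->]]]|//]; exact: sin_angle_ge0.
Qed.

(** The [Y k] form an orthonormal basis of [B]. Projecting each of them to the line of [X k] moves
    each of the [\dim B] components of [y] by at most the largest sine times the norm of [y]. *)
Lemma psi_approx A B y : \dim A = \dim B -> y \in B -> exists2 x, x \in A &
  enorm (y - x) <= (\dim B)%:R * psi (\dim B) A B * enorm y.
Proof.
move=> dAB yB; have [X [Y [cXY ->]]] := @psi_canonical A B (\dim B)
  (eq_leq (esym dAB)) (leqnn _).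
have [onX onY] := canonical_pairs_orthonormal cXY.
exists (\sum_(k < \dim B) (dotv y (Y k) * dotv (X k) (Y k)) *: X k).
  by apply: memv_suml => k _; apply: memvZ; exact: (orthonormal_mem onX).
rewrite {1}(orthonormal_decomp onY yB) -sumrB (le_trans (enorm_sum _ _ _))//.
rewrite -mulrA mulr_natl -[X in _ *+ X]card_ord -sumr_const.
apply: ler_sum => k _; rewrite -scalerA -scalerBr enormZ mulrC.
have [[_ X1] [_ Y1] _] := cXY _ (ltn_ord k).
apply: ler_pM => //; rewrite ?enorm_ge0//.
  by rewrite enorm_sub_proj//; exact: canonical_pairs_mono cXY _.
by rewrite (le_trans (norm_dotv_le _ _))// Y1 mulr1.
Qed.

(* Subtracting from an approximation x of Y j its components along the X i,
   i < j, leaves an admissible vector, and these components are controlled by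
   the earlier angles since Y j is orthogonal to Y i. *)
Lemma psi_le A B j (e : R) : (0 < j)%N -> (j <= \dim A)%N -> (j <= \dim B)%N ->
  (forall y, y \in B -> exists2 x, x \in A & enorm (y - x) <= e * enorm y) ->
  2 ^+ j * e < 1 -> psi j A B <= 2 ^+ j * e.
Proof.
move=> j0 jA jB appr je1; have [X [Y [cXY ->]]] := psi_canonical jA jB.
have [onX onY] := canonical_pairs_orthonormal cXY.
have e0 : 0 <= e.
  have Y0B : Y 0%N \in B := orthonormal_mem onY j0.
  have [x _] := appr _ Y0B; have [_ ->] := onY _ j0.
  by rewrite mulr1; apply: le_trans (enorm_ge0 _).
(* The constants solve [c_i = 1 + \sum_(k < i) (1 + c_k)]: the error of [x] itself, then that of
   each subtracted component. *)
suff H i : (i < j)%N -> sin_angle (X i) (Y i) <= (2 ^+ i.+1 - 1) * e.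
  have j1 : (j.-1 < j)%N by rewrite prednK.
  by rewrite (le_trans (H _ j1))// prednK// ler_wpM2r// lerBlDr lerDl.
elim/ltn_ind: i => i IHi ij.
have [[XA X1] [YB Y1] Hmin] := cXY _ ij.
have [x xA xe] := appr _ (orthonormal_mem onY ij); rewrite Y1 mulr1 in xe.
pose x' := x - \sum_(k < i) dotv x (X k) *: X k.
have onXi : orthonormal_in A i X by move=> k ki; apply/onX/(ltn_trans ki).
have x'A : orth_in A (mkseq X i) x' by exact: orthonormal_residual.
have dist : enorm (Y i - x') <= (2 ^+ i.+1 - 1) * e.
  rewrite /x' opprB addrCA addrC (le_trans (enormD _ _))//.
  apply: (@le_trans _ _ (e + \sum_(k < i) 2 ^+ k.+1 * e)).
    apply: lerD => //; rewrite (le_trans (enorm_sum _ _ _))//.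
    apply: ler_sum => k _; rewrite enormZ.
    have kj : (k < j)%N := ltn_trans (ltn_ord k) ij.
    have [[_ Xk1] [_ Yk1] _] := cXY _ kj; rewrite Xk1 mulr1.
    have YiYk : dotv (Y i) (Y k) = 0.
      by rewrite (orthonormal_dotv onY)// gtn_eqF.
    (* Since [Y i] is orthogonal to [Y k], only two small terms remain: the error of [x], and the
       part of [X k] orthogonal to [Y k], whose norm is an earlier sine. *)
    have -> : dotv x (X k) = dotv (x - Y i) (X k) +
        dotv (Y i) (X k - dotv (Y k) (X k) *: Y k).
      by rewrite !dotvE YiYk; ring.
    rewrite (le_trans (ler_normD _ _))// (_ : _ * e = e + (2 ^+ k.+1 - 1) * e).
      apply: lerD; rewrite (le_trans (norm_dotv_le _ _))//.
        by rewrite Xk1 mulr1 -enormN opprB.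
      by rewrite Y1 mul1r enorm_sub_proj// sin_angleC IHi.
    by ring.
  rewrite -mulr_suml -{1}[e]mul1r -mulrDl ler_wpM2r//.
  have -> : forall m, \sum_(k < m) 2 ^+ k.+1 = 2 ^+ m.+1 - 2 :> R.
    elim=> [|m IHm]; first by rewrite big_ord0 expr1 subrr.
    by rewrite big_ord_recr IHm/= [in RHS]exprS; ring.
  by rewrite lerBrDr -addrA; lra.
(* If [x'] were 0, the distance would be 1, against [2 ^+ j * e < 1]. *)
have x'0 : x' != 0.
  apply: contraTneq dist => ->; rewrite subr0 Y1 -ltNge.
  apply: le_lt_trans je1; rewrite ler_wpM2r//.
  rewrite lerBlDr (le_trans (_ : _ <= 2 ^+ j))//; last by rewrite lerDl.
  by rewrite ler_weXn2l// ler1n.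
apply: le_trans (Hmin _ _ x'A x'0 YB _) _; first by rewrite -enorm_gt0 Y1.
exact: le_trans (sin_angle_le_dist x'0 Y1) dist.
Qed.

End CanonicalPairs.

(** * Minors and Pluecker coordinates *)

Section Minors.
Context {d n : nat}.

(** Arbitrary maps [f] are allowed, so that replacing one column gives a minor again. *)
Definition minor {S : comNzRingType} (M : 'M[S]_(d, n)) (f : 'I_d -> 'I_n) : S :=
  \det (colsub f M).

Lemma minor_mulmx {S : comNzRingType} (K : 'M[S]_d) (M : 'M[S]_(d, n)) f :
  minor (K *m M) f = \det K * minor M f.
Proof. by rewrite /minor -mulmx_colsub det_mulmx. Qed.

Lemma minor_map {S T : comNzRingType} (phi : {rmorphism S -> T})
    (M : 'M[S]_(d, n)) f :
  minor (map_mx phi M) f = phi (minor M f).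
Proof. by rewrite /minor -map_mxsub det_map_mx. Qed.

Lemma plucker_index_sort (f : 'I_d -> 'I_n) : injective f ->
  exists (g : plucker_index d n) (s : 'S_d), forall k, f k = val g (s k).
Proof.
move=> f_inj; pose A := (f @: [set: 'I_d])%SET; pose e := enum A.
have se : size e = d by rewrite -cardE card_imset// cardsT card_ord.
have e_sorted : sorted ltn (map val e).
  apply: (subseq_sorted ltn_trans _ (iota_ltn_sorted 0 n)).
  by rewrite -val_enum_ord map_subseq// /e enumT filter_subseq.
pose g := [ffun i : 'I_d => nth (f i) e i].
have gP : [forall i : 'I_d, forall k : 'I_d, (i < k)%N ==> (g i < g k)%N].
  apply/forallP => i; apply/forallP => k; apply/implyP => ik; rewrite !ffunE.
  rewrite (set_nth_default (f i)) ?se// -!(nth_map _ 0%N val) ?se//.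
  by apply: (sorted_ltn_nth ltn_trans 0%N e_sorted); rewrite ?inE ?size_map ?se.
have fe k : f k \in e by rewrite mem_enum imset_f.
have idx k : (index (f k) e < d)%N by rewrite -se index_mem.
have sinj : injective (fun k => Ordinal (idx k)).
  move=> k1 k2 [] E; apply: f_inj.
  by rewrite -(nth_index (f k1) (fe k1)) E nth_index.
exists (exist _ g gP), (perm sinj) => k.
by rewrite /= permE ffunE nth_index.
Qed.

(** Sorting the columns. The alternative, [g] and the sign depend on [f] alone, so they can be
    shared by several matrices. *)
Lemma minor_alternate (f : 'I_d -> 'I_n) :
  (forall (S : comNzRingType) (M : 'M[S]_(d, n)), minor M f = 0) \/
  exists (g : plucker_index d n) (b : bool),
    forall (S : comNzRingType) (M : 'M[S]_(d, n)),
      minor M f = (-1) ^+ b * minor M (val g).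
Proof.
case: (boolP (injectiveb f)) => [/injectiveP/plucker_index_sort[g [s fE]]|].
  right; exists g, (odd_perm s) => S M; rewrite /minor.
  have -> : colsub f M = (perm_mx s *m (colsub (val g) M)^T)^T.
    by rewrite -row_permE; apply/matrixP => i j; rewrite !mxE fE.
  by rewrite det_tr det_mulmx det_tr det_perm.
move=> /injectivePn[i [k ik fik]]; left=> S M.
rewrite /minor -det_tr (determinant_alternate ik)// => j.
by rewrite !mxE fik.
Qed.

(** Cramer's rule. It recovers a matrix from its minors up to row operations, and it bounds
    coordinates by minors in [rational_short_vector]. *)
Lemma adj_colsub_mul {S : comNzRingType} (M : 'M[S]_(d, n)) f i k :
  (\adj (colsub f M) *m M) i k = minor M (fun j => if j == i then k else f j).
Proof.
rewrite /minor (expand_det_col _ i) mxE; apply: eq_bigr => j _.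
rewrite !mxE eqxx mulrC; congr (_ * (_ * \det _)).
by apply/matrixP => u v; rewrite !mxE eq_sym (negPf (neq_lift _ _)).
Qed.

Lemma row_free_minor {F : fieldType} (M : 'M[F]_(d, n)) :
  row_free M -> exists g : plucker_index d n, minor M (val g) != 0.
Proof.
move=> Mfree; have Mfull : row_full M^T by rewrite /row_full mxrank_tr.
have [f0|[g [b fE]]] := minor_alternate (fullrankfun Mfull).
  have := fullrowsub_unit Mfull; rewrite unitmxE -det_tr.
  have := f0 _ M; rewrite /minor => fM0.
  rewrite (_ : (_)^T = colsub (fullrankfun Mfull) M) ?fM0 ?unitr0//.
  by apply/matrixP => i j; rewrite !mxE.
exists g; have := fullrowsub_unit Mfull; rewrite unitmxE -det_tr.
rewrite (_ : (_)^T = colsub (fullrankfun Mfull) M); last first.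
  by apply/matrixP => i j; rewrite !mxE.
rewrite -/(minor _ _) fE unitfE mulf_eq0 negb_or.
by move=> /andP[].
Qed.

Lemma minor_cross {F : fieldType} (M M' : 'M[F]_(d, n)) f g :
  (M <= M')%MS -> minor M f * minor M' g = minor M g * minor M' f.
Proof. by move=> /submxP[K ->]; rewrite !minor_mulmx; ring. Qed.

(** Injectivity of the Pluecker embedding: multiplying by the adjugate of an invertible submatrix
    keeps the row space, and all entries of the product are minors. *)
Lemma mxspan_eq_minor {F : fieldType} (M M' : 'M[F]_(d, n)) :
  row_free M -> (forall g : plucker_index d n, minor M (val g) = minor M' (val g)) ->
  mxspan M = mxspan M'.
Proof.
move=> Mfree eqg; have eqf f : minor M f = minor M' f.
  have [f0|[g [b fE]]] := minor_alternate f; first by rewrite !f0.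
  by rewrite !fE eqg.
have [g g0] := row_free_minor Mfree.
have eqK (N : 'M[F]_(d, n)) : minor N (val g) != 0 ->
    (\adj (colsub (val g) N) *m N :=: N)%MS.
  move=> N0; apply: eqmxMfull.
  have : \adj (colsub (val g) N) *m ((minor N (val g))^-1 *: colsub (val g) N) = 1%:M.
    by rewrite -scalemxAr mul_adj_mx scale_scalar_mx mulVf.
  by case/mulmx1_unit; rewrite row_full_unit.
have g0' : minor M' (val g) != 0 by rewrite -eqf.
rewrite -(eq_mxspan (eqK M g0)) -(eq_mxspan (eqK M' g0')).
by congr mxspan; apply/matrixP => i k; rewrite !adj_colsub_mul eqf.
Qed.

Lemma plucker_minor {R : realType} (s : d.-tuple 'rV[R]_n) (g : plucker_index d n) :
  plucker s g = minor (tuple_mx s) (val g).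
Proof. by congr (\det _); apply/matrixP => i k; rewrite !mxE. Qed.

End Minors.

(** * Heights *)

Section Heights.
Context {R : realType} {n : nat}.
Implicit Types (B : {vspace 'rV[R]_n}).

Local Notation "W %:mxR" := (map_mx (intr : int -> R) W) (at level 2, format "W %:mxR").

Lemma biggcdn_mull (I : finType) (F : I -> nat) m :
  \big[gcdn/0%N]_i (m * F i)%N = (m * \big[gcdn/0%N]_i F i)%N.
Proof.
by apply/esym/(big_morph (muln m) (fun x y => muln_gcdr m x y) (muln0 m)).
Qed.

Lemma dvdn_biggcd (I : finType) (F : I -> nat) i :
  (\big[gcdn/0%N]_i F i %| F i)%N.
Proof. exact: biggcdn_inf. Qed.

(** Multiply [v f] by the gcd of [Xi], which is 1, move it inside the gcd, exchange the two factors
    and take [Xi f] out. Thus primitive integral coordinates are unique up to sign. *)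
Lemma primitive_proportional (I : finType) (Xi v : I -> int) :
  (forall f g, Xi f * v g = Xi g * v f) -> \big[gcdn/0%N]_f `|Xi f|%N = 1%N ->
  forall f, `|v f|%N = (`|Xi f| * \big[gcdn/0%N]_g `|v g|)%N.
Proof.
move=> cross Xi1 f; rewrite -biggcdn_mull -[LHS]muln1 -Xi1 -biggcdn_mull.
by apply: eq_bigr => g _; rewrite -!abszM cross mulrC.
Qed.

Lemma plucker_cross B (e : nat) (s s' : e.-tuple 'rV[R]_n) f g :
  basis_of B s -> basis_of B s' ->
  plucker s f * plucker s' g = plucker s g * plucker s' f.
Proof.
move=> /basis_tuple_mx[_ sB] /basis_tuple_mx[_ s'B].
rewrite !plucker_minor; apply: minor_cross; apply/rV_subP => x.
by rewrite -!mem_mxspan -sB -s'B.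
Qed.

Lemma primitive_plucker_cross B Xi v (s : (\dim B).-tuple 'rV[R]_n) :
  primitive_plucker (B := B) Xi -> basis_of B s ->
  (forall f, plucker s f = (v f)%:~R) ->
  forall f, `|v f|%N = (`|Xi f| * \big[gcdn/0%N]_g `|v g|)%N.
Proof.
move=> [[s' bs' s'Xi] Xi1] bs sv; apply: primitive_proportional => // f g.
have := plucker_cross f g bs' bs; rewrite !sv !s'Xi -!intrM.
by move=> /intr_inj.
Qed.

Lemma height_primitive B Xi : primitive_plucker (B := B) Xi ->
  height B = Num.sqrt (\sum_f (Xi f)%:~R ^+ 2).
Proof.
move=> XiB; rewrite /height; case: xgetP => [h _ [v [[s bs sv] v1] ->]|]; last first.
  by move=> /(_ (Num.sqrt (\sum_f (Xi f)%:~R ^+ 2)))[]; exists Xi.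
congr (Num.sqrt _); apply: eq_bigr => f _.
rewrite -[LHS](real_normK (num_real _)) -[RHS](real_normK (num_real _)).
by rewrite -!intr_norm -!abszE (primitive_plucker_cross XiB bs sv) v1 muln1.
Qed.

Lemma coord_le_height B Xi f : primitive_plucker (B := B) Xi ->
  `|Xi f|%:~R <= height B.
Proof.
move=> XiB; rewrite (height_primitive XiB) intr_norm -sqrtr_sqr.
apply: ler_wsqrtr; rewrite (bigD1 f)//= lerDl.
by apply: sumr_ge0 => g _; rewrite sqr_ge0.
Qed.

Lemma primitive_neq0 B Xi : primitive_plucker (B := B) Xi ->
  exists f, Xi f != 0.
Proof.
move=> [_ Xi1]; apply: contrapT => /forallNP Xi0; move: Xi1; rewrite big1// => f _.
by have /negP := Xi0 f; rewrite negbK => /eqP ->.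
Qed.

Lemma height_ge1 B Xi : primitive_plucker (B := B) Xi -> 1 <= height B.
Proof.
move=> XiB; have [f f0] := primitive_neq0 XiB.
apply: le_trans (coord_le_height f XiB).
by rewrite ler1z -gtz0_ge1 normr_gt0.
Qed.

Lemma map_intr_row_free d (W : 'M[int]_(d, n)) (V : 'M[int]_(n, d)) :
  W *m V = 1%:M -> row_free W%:mxR.
Proof.
by move=> WV; apply/row_freeP; exists V%:mxR; rewrite -map_mxM WV map_mx1.
Qed.

(** A prime dividing all maximal minors would make [W] rank deficient modulo this prime, but the
    reduction of [V] is still a right inverse. *)
Lemma biggcd_minor_eq1 d (W : 'M[int]_(d, n)) (V : 'M[int]_(n, d)) :
  W *m V = 1%:M ->
  \big[gcdn/0%N]_(f : plucker_index d n) `|minor W (val f)|%N = 1%N.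
Proof.
move=> WV; set g := LHS; apply/eqP/negPn/negP => g1.
have [p p_pr pg] : exists2 p, prime p & (p %| g)%N.
  have [g0|g_gt0] := posnP g; first by exists 2%N; rewrite ?g0.
  by exists (pdiv g); rewrite ?pdiv_dvd// pdiv_prime// ltn_neqAle eq_sym g1.
have Wfree : row_free (map_mx (intr : int -> 'F_p) W).
  by apply/row_freeP; exists (map_mx intr V); rewrite -map_mxM WV map_mx1.
have [f] := row_free_minor Wfree; rewrite minor_map.
have := dvdn_trans pg (dvdn_biggcd (fun f : plucker_index d n => `|minor W (val f)|%N) f).
by rewrite -(dvdz_pcharf (pchar_Fp p_pr)) dvdzE /= => ->.
Qed.

Lemma rat_row_clear_denoms (q : 'rV[rat]_n) : exists (D : int) (w : 'rV[int]_n),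
  D != 0 /\ D%:~R *: map_mx (ratr : rat -> R) q = w%:mxR.
Proof.
exists (\prod_j denq (q 0 j)).
exists (\row_j (numq (q 0 j) * \prod_(k | k != j) denq (q 0 k))).
split; first by apply/prodf_neq0 => j _; rewrite denq_neq0.
apply/rowP => j; rewrite !mxE (bigD1 j)//= !intrM mulrAC.
congr (_ * _); have -> : ratr (q 0 j) = (numq (q 0 j))%:~R / (denq (q 0 j))%:~R :> R.
  by rewrite -[in LHS](divq_num_den (q 0 j)) fmorph_div /= !ratr_int.
by rewrite mulrC divfK// intr_eq0 denq_neq0.
Qed.

(* The Smith normal form of any integral basis of B provides an integral basis
   with an integral right inverse. *)
Lemma rational_unimodular_basis B : is_rational B ->
  exists (W : 'M[int]_(\dim B, n)) (V : 'M[int]_(n, \dim B)),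
    W *m V = 1%:M /\ B = mxspan W%:mxR.
Proof.
move=> [s bs srat]; have ss := size_basis (X := in_tuple s) bs.
pose t : (\dim B).-tuple 'rV[R]_n := tcast (esym ss) (in_tuple s).
have ts : t = s :> seq _ by rewrite val_tcast.
have bt : basis_of B t by rewrite ts.
have [tfree tB] := basis_tuple_mx bt.
have /choice[D /choice[w Dw]] : forall i : 'I_(\dim B), exists (D : int) (w : 'rV[int]_n),
    D != 0 /\ D%:~R *: tnth t i = w%:mxR.
  move=> i; have [|q ->] := srat (tnth t i); first by rewrite -ts mem_tnth.
  exact: rat_row_clear_denoms.
pose W0 : 'M[int]_(\dim B, n) := \matrix_i w i.
have W0E : W0%:mxR = diag_mx (\row_i (D i)%:~R) *m tuple_mx t.
  apply/row_matrixP => i; rewrite row_mul row_diag_mx mxE -scalemxAl -rowE rowK.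
  by rewrite -map_row rowK; have [_ ->] := Dw i.
have W0B : B = mxspan W0%:mxR.
  rewrite {1}tB W0E; apply/esym/eq_mxspan/eqmxMfull.
  rewrite row_full_unit unitmxE det_diag unitfE; apply/prodf_neq0 => i _.
  by rewrite mxE intr_eq0; have [] := Dw i.
have dn : (\dim B <= n)%N.
  by have := rank_leq_col (tuple_mx t); rewrite (eqP tfree).
have [L Lu [Q Qu [ds _ W0S]]] := int_Smith_normal_form W0.
(* The first [\dim B] rows of the unimodular matrix [Q], and the matching columns of its inverse. *)
pose W : 'M[int]_(\dim B, n) := pid_mx (\dim B) *m Q.
pose V : 'M[int]_(n, \dim B) := invmx Q *m pid_mx (\dim B).
have WV : W *m V = 1%:M.
  rewrite /W /V mulmxA mulmxK// mul_pid_mx -pid_mx_1; congr pid_mx.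
  by rewrite minnn (minn_idPr dn).
exists W, V; split => //; have Wfree := map_intr_row_free WV.
apply/eqP; rewrite eqEdim dim_mxspan// leqnn andbT {1}W0B.
apply/subvP => x; rewrite !mem_mxspan => /submx_trans; apply.
suff -> : W0 = (L *m diag_mx (\row_i ds`_i)) *m W by rewrite map_mxM submxMl.
rewrite W0S /W !mulmxA; congr (_ *m _); rewrite -mulmxA; congr (_ *m _).
apply/matrixP => i k; rewrite mxE [RHS]mxE (bigD1 i)//= big1 ?addr0.
  by rewrite !mxE eqxx ltn_ord andbT mulr1n mulr_natr.
by move=> l li; rewrite !mxE eq_sym (negPf li) mulr0n mul0r.
Qed.

Lemma unimodular_primitive B (W : 'M[int]_(\dim B, n)) (V : 'M[int]_(n, \dim B)) :
  W *m V = 1%:M -> B = mxspan W%:mxR ->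
  primitive_plucker (B := B) (fun f => minor W (val f)).
Proof.
move=> WV WB; have Wfree := map_intr_row_free WV.
split; last exact: biggcd_minor_eq1 WV.
exists [tuple row i W%:mxR | i < \dim B].
  by rewrite [X in basis_of X]WB; exact: mxspan_basis.
move=> f; rewrite plucker_minor -minor_map; congr minor.
by apply/row_matrixP => i; rewrite rowK tnth_mktuple.
Qed.

Lemma rational_primitive B : is_rational B ->
  exists Xi, primitive_plucker (B := B) Xi.
Proof.
move=> /rational_unimodular_basis[W [V [WV WB]]].
by eexists; exact: unimodular_primitive WV WB.
Qed.

Lemma is_rational_mxspan d (W : 'M[int]_(d, n)) : row_free W%:mxR ->
  is_rational (mxspan W%:mxR).
Proof.
move=> Wfree; exists [tuple row i W%:mxR | i < d]; first exact: mxspan_basis.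
move=> x /tnthP[i ->]; exists (map_mx intr (row i W)); rewrite tnth_mktuple.
by apply/rowP => j; rewrite !mxE ratr_int.
Qed.

(** The minors of an integral basis are the primitive coordinates times their gcd, a positive
    integer, so they can only overestimate the height. *)
Lemma height_integral_le B d (W : 'M[int]_(d, n)) (T : R) :
  \dim B = d -> B = mxspan W%:mxR ->
  (forall f : plucker_index d n, `|minor W%:mxR (val f)| <= T) ->
  1 <= height B <= Num.sqrt (#|{: plucker_index d n}|%:R * T ^+ 2).
Proof.
move=> dB; subst d => WB WT.
have Wfree : row_free W%:mxR.
  by rewrite /row_free -(dim_mxspan (row_base_free W%:mxR)) (eq_mxspan (eq_row_base _)) -WB.
have [Xi XiB] : exists Xi, primitive_plucker (B := B) Xi.
  by apply: rational_primitive; rewrite WB; exact: is_rational_mxspan.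
have bW : basis_of B [tuple row i W%:mxR | i < \dim B].
  by rewrite [X in basis_of X]WB; exact: mxspan_basis.
have bWE f : plucker [tuple row i W%:mxR | i < \dim B] f = (minor W (val f))%:~R.
  rewrite plucker_minor -minor_map; congr minor.
  by apply/row_matrixP => i; rewrite rowK tnth_mktuple.
have XiW := primitive_plucker_cross XiB bW bWE.
rewrite (height_ge1 XiB) (height_primitive XiB) /=.
apply: ler_wsqrtr; rewrite mulr_natl -sumr_const; apply: ler_sum => f _.
have T0 : 0 <= T := le_trans (normr_ge0 _) (WT f).
rewrite -(real_normK (num_real _)) ler_pXn2r ?nnegrE//.
apply: le_trans (WT f); rewrite minor_map -!intr_norm ler_int -!abszE lez_nat XiW.
rewrite leq_pmulr// lt0n; have [g g0] := row_free_minor Wfree.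
apply: contraNneq g0 => gcd0; rewrite minor_map intr_eq0 -absz_eq0.
by rewrite (XiW g) gcd0 muln0.
Qed.

End Heights.

(** * Short vectors and Northcott's theorem *)

(* The classes of 'rV[int]_d modulo the lattice spanned by the rows of K are
   counted through the Smith normal form of K. *)
Lemma lattice_pigeonhole d (K : 'M[int]_d) (m : nat) :
  (0 < `|\det K| < m.+1 ^ d)%N ->
  exists2 c : 'rV[int]_d, c != 0 & forall i, (`|(c *m K) 0%R i| <= m)%N.
Proof.
move=> /andP[K0 Km]; have [L Lu [Q Qu [ds _ KE]]] := int_Smith_normal_form K.
pose D : 'rV[int]_d := \row_i ds`_i.
have {}KE : K = L *m diag_mx D *m Q.
  rewrite KE; congr (_ *m _ *m _); apply/matrixP => i k.
  by rewrite !mxE val_eqE.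
have absu (N : 'M[int]_d) : N \in unitmx -> `|\det N|%N = 1%N.
  by rewrite unitmxE => /orP[]/eqP ->.
have KD : `|\det K|%N = (\prod_i `|D 0%R i|)%N.
  rewrite KE !det_mulmx !abszM (absu L)// (absu Q)// mul1n muln1 det_diag.
  by rewrite (big_morph absz abszM absz1).
have D_gt0 i : (0 < `|D 0%R i|)%N.
  by move: K0; rewrite KD (bigD1 i)//= muln_gt0 => /andP[].
(* The [m.+1 ^ d] integral points of the cube with sides from 0 to [m]. *)
pose v (y : {ffun 'I_d -> 'I_m.+1}) : 'rV[int]_d := \row_i (y i : nat)%:Z.
have ltD (y : {ffun 'I_d -> 'I_m.+1}) i :
    (`|((v y *m invmx Q) 0%R i %% D 0%R i)%Z| < `|D 0%R i|)%N.
  by rewrite -ltz_nat !abszE ger0_norm ?modz_ge0 -?absz_gt0// ltz_mod// -absz_gt0.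
(* The class of [v y] modulo the lattice: after the change of basis [Q] the lattice is diagonal, and
   there are [|det K|] classes, fewer than points. *)
pose phi y : {dffun forall i : 'I_d, 'I_(`|D 0%R i|)} :=
  [ffun i => Ordinal (ltD y i)].
have /injectivePn[y [y' yy' phiE]] : ~~ injectiveb phi.
  apply/negP => /injectiveP/leq_card; apply/negP; rewrite -ltnNge.
  rewrite card_dep_ffun foldrE big_map big_enum /= card_ffun !card_ord.
  by under eq_bigr do rewrite card_ord; rewrite -KD.
have dvdD i : (D 0%R i %| ((v y - v y') *m invmx Q) 0%R i)%Z.
  have /(congr1 val) := congr1 (fun f : {dffun forall i : 'I_d, 'I_(`|D 0%R i|)} => f i) phiE.
  rewrite !ffunE /= => E; rewrite mulmxBl mxE [(- _ : 'rV_d) _ _]mxE.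
  rewrite -eqz_mod_dvd; apply/eqP.
  by have := congr1 Posz E; rewrite !abszE !ger0_norm// modz_ge0// -absz_gt0.
pose t : 'rV[int]_d := \row_i (((v y - v y') *m invmx Q) 0%R i %/ D 0%R i)%Z.
have tE : t *m invmx L *m K = v y - v y'.
  rewrite KE !mulmxA mulmxKV// -[RHS](mulmxKV Qu); congr (_ *m _).
  apply/rowP => i; rewrite mul_mx_diag mxE [t _ _]mxE divzK//.
exists (t *m invmx L) => [|i]; last first.
  rewrite tE !mxE -lez_nat abszE ler_norml.
  move: (ltn_ord (y i)) (ltn_ord (y' i)); move: (nat_of_ord (y i)) (nat_of_ord (y' i)).
  by move=> a b am bm; lia.
apply: contraNneq yy' => t0; move: tE; rewrite t0 mul0mx => /esym/eqP.
rewrite subr_eq0 => /eqP/rowP vE; apply/eqP/ffunP => i; apply: val_inj.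
by have := vE i; rewrite !mxE => -[].
Qed.

Lemma root_floor (q d : nat) : (0 < d)%N -> exists m, (m ^ d <= q < m.+1 ^ d)%N.
Proof.
move=> d0; have ex : exists m, (q < m.+1 ^ d)%N.
  by exists q; rewrite (leq_trans (ltnSn q))// -[X in (X <= _)%N]expn1 leq_pexp2l.
exists (ex_minn ex); case: ex_minnP => -[|m] qm mmin; rewrite qm andbT.
  by rewrite exp0n.
by rewrite leqNgt; apply/negP => /mmin; rewrite ltnn.
Qed.

Section ShortVectors.
Context {R : realType} {n : nat}.
Implicit Types (B : {vspace 'rV[R]_n}).

Local Notation "W %:mxR" := (map_mx (intr : int -> R) W) (at level 2, format "W %:mxR").

(* Minkowski's theorem in B: with f the largest minor of a unimodular basis W,
   the coordinates of a vector of B are at most \dim B times the largest of its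
   coordinates indexed by f. *)
Lemma rational_short_vector B : is_rational B -> (0 < \dim B)%N ->
  exists x : 'rV[int]_n, [/\ x != 0, x%:mxR \in B &
    forall k, `|x%:mxR 0 k| ^+ \dim B <= (\dim B)%:R ^+ \dim B * height B].
Proof.
move=> ratB d_gt0; have [W [V [WV WB]]] := rational_unimodular_basis ratB.
have Wprim := unimodular_primitive WV WB; have [f0 f0_neq0] := primitive_neq0 Wprim.
(* [f0] only witnesses that there is an index, as the maximum requires; its minor is nonzero, so the
   largest one is too. *)
pose a (f : plucker_index (\dim B) n) := `|minor W (val f)|%N.
pose f := [arg max_(f > f0) a f].
have fmax g : (a g <= a f)%N by rewrite /f; case: arg_maxnP => // i _; apply.
have fmax' g : (`|minor W g| <= a f)%N.
  have [->|[g' [b ->]]] := minor_alternate g; first by rewrite absz0.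
  by rewrite abszM abszX/= exp1n mul1n fmax.
have f_gt0 : (0 < a f)%N by apply: leq_trans (fmax f0); rewrite lt0n absz_eq0.
(* [m] is the integral part of the [\dim B]-th root of the largest minor: [fm] feeds the pigeonhole
   and [mf] gives the final bound. *)
have [m /andP[mf fm]] := root_floor (a f) d_gt0.
have [|c c0 cm] := @lattice_pigeonhole _ (colsub (val f) W) m; first exact/andP.
have xbound k : (`|(c *m W) 0%R k| <= \dim B * m)%N.
  rewrite -(leq_pmul2l f_gt0) /a /minor -abszM.
  (* By Cramer's rule, the determinant times [c *m W] combines minors of [W], each at most [a f],
     with the coefficients [c *m colsub (val f) W], each at most [m]. *)
  have -> : \det (colsub (val f) W) * (c *m W) 0 k =
      ((c *m colsub (val f) W) *m (\adj (colsub (val f) W) *m W)) 0 k.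
    by rewrite -mulmxA (mulmxA _ _ W) mul_mx_adj mul_scalar_mx -scalemxAr [RHS]mxE.
  rewrite mxE; apply: (@leq_trans (\sum_(i < \dim B) m * a f)%N); last first.
    by rewrite sum_nat_const card_ord mulnCA mulnA [leqLHS]mulnC (mulnC m) mulnCA mulnA.
  rewrite -lez_nat abszE (le_trans (ler_norm_sum _ _ _))// -natz natr_sum.
  apply: ler_sum => i _; rewrite normrM natz -!abszE -PoszM lez_nat leq_mul//.
  by rewrite adj_colsub_mul.
exists (c *m W); split.
- by apply: contraNneq c0 => cW; rewrite -[c]mulmx1 -WV mulmxA cW mul0mx.
- have memB v : v \in mxspan W%:mxR -> v \in B by rewrite -WB.
  by apply: memB; rewrite mem_mxspan map_mxM submxMl.
move=> k; rewrite mxE -intr_norm -abszE -pmulrn.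
apply: (@le_trans _ _ ((\dim B)%:R ^+ \dim B * (a f)%:R)); last first.
  by rewrite ler_wpM2l ?exprn_ge0// (le_trans _ (coord_le_height f Wprim))// -abszE.
rewrite -!natrX -natrM ler_nat (@leq_trans ((\dim B * m) ^ \dim B))//.
  by rewrite leq_exp2r.
by rewrite expnMn leq_mul.
Qed.

(** A bounded height leaves finitely many integral Pluecker vectors, and each determines its
    subspace. *)
Lemma northcott d (T : R) :
  finite_set [set B : {vspace 'rV[R]_n} | rational_subspaces d B /\ height B <= T].
Proof.
pose K := Num.bound `|T|.
(* Integers between [- K] and [K] are encoded as ordinals, shifted by [K]. *)
pose P (phi : {ffun plucker_index d n -> 'I_(K + K).+1}) : set {vspace 'rV[R]_n} :=
  [set B | exists2 W : 'M[R]_(d, n), row_free W /\ B = mxspan W &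
    forall f : plucker_index d n, minor W (val f) = ((phi f : nat)%:Z - K%:Z)%:~R].
have P1 phi : is_subset1 (P phi).
  move=> B B' [W [Wfree ->] WE] [W' [W'free ->] W'E].
  by apply: mxspan_eq_minor => // f; rewrite WE W'E.
apply: (@sub_finite_set _ _ ((fun phi => xget 0%VS (P phi)) @` setT)); last first.
  exact/finite_image/finite_finset.
move=> B [[ratB dB] BT]; subst d.
have [Xi XiB] := rational_primitive ratB.
have XiK f : `|Xi f| <= K%:Z.
  rewrite -(ler_int R) (le_trans (coord_le_height f XiB))// (le_trans BT)//.
  by rewrite (le_trans (ler_norm _))//; exact: ltW (archi_boundP (normr_ge0 T)).
have [[s bs sXi] _] := XiB; have [sfree sB] := basis_tuple_mx bs.
exists [ffun f => inord (absz (Xi f + K%:Z))] => //=.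
apply: xget_subset1 (P1 _); exists (tuple_mx s) => // f.
rewrite -plucker_minor sXi ffunE inordK.
  by rewrite gez0_abs ?addrK//; have := XiK f; rewrite ler_norml; lia.
by have := XiK f; rewrite ler_norml; lia.
Qed.

End ShortVectors.

(** * Lower bound *)

Section LowerBound.
Context {R : realType}.

Local Notation "W %:mxR" := (map_mx (intr : int -> R) W) (at level 2, format "W %:mxR").

Lemma enorm_mulmx_le a b (E : 'M[R]_(a, b)) t x : (forall i j, `|E i j| <= t) ->
  enorm (x *m E) <= b%:R * (a%:R * t) * enorm x.
Proof.
move=> Et; rewrite -mulrA; apply: enorm_le => j; rewrite mxE.
rewrite (le_trans (ler_norm_sum _ _ _))//.
apply: (@le_trans _ _ (\sum_(i < a) t * enorm x)).
  apply: ler_sum => i _; rewrite normrM mulrC ler_pM//; exact: coord_le_enorm.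
by rewrite sumr_const card_ord -mulrA mulr_natl.
Qed.

Lemma mx_entry_bound a b (M : 'M[R]_(a, b)) : exists2 t : R, 0 < t & forall i j, `|M i j| <= t.
Proof.
exists (1 + \sum_i \sum_j `|M i j|).
  by rewrite ltr_pwDl// sumr_ge0// => i _; rewrite sumr_ge0.
move=> i j; rewrite (bigD1 i)//= (bigD1 j)//= addrCA -addrA lerDl.
by rewrite !addr_ge0// sumr_ge0// => k _; rewrite ?sumr_ge0.
Qed.

Lemma det_le d (X : 'M[R]_d) t : (forall i j, `|X i j| <= t) ->
  `|\det X| <= d`!%:R * t ^+ d.
Proof.
move=> Xt; rewrite /determinant (le_trans (ler_norm_sum _ _ _))//.
rewrite mulr_natl -card_Sn -sumr_const; apply: ler_sum => s _.
rewrite normrM normrX normrN1 expr1n mul1r normr_prod.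
rewrite -[X in _ ^+ X]card_ord -prodr_const; apply: ler_prod => i _.
by rewrite normr_ge0 Xt.
Qed.

Definition round_mx a b (M : 'M[R]_(a, b)) : 'M[int]_(a, b) :=
  map_mx (Num.floor : R -> int) M.

Lemma round_mx_err a b (M : 'M[R]_(a, b)) i j : `|((round_mx M)%:mxR - M) i j| <= 1.
Proof.
rewrite !mxE; have /andP[] := floor_itv (M i j); rewrite intrD ler_norml; lra.
Qed.

(** * Integral approximations of a subspace *)

Section Approximation.
Context {d n : nat} (M : 'M[R]_(d, n)).

(** Write [W = q M + E] with [E] bounded. A right inverse of [M] shows that [c *m W] has norm at
    least of order [q] times that of [c], so [W] is free and the error [c *m E] is relatively of
    order [1 / q]. *)
Lemma round_mx_free_dist : row_free M -> exists2 C : R, 0 < C &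
  exists Q : nat, forall q : nat, (Q <= q)%N ->
    let W := (round_mx (q%:R *: M))%:mxR in
    row_free W /\ forall y, y \in mxspan W -> exists2 x, x \in mxspan M &
      enorm (y - x) <= C / q%:R * enorm y.
Proof.
move=> /row_freeP[N MN]; have [t t_gt0 Nt] := mx_entry_bound N.
pose K : R := d%:R * (n%:R * t); pose a : R := n%:R * (d%:R * 1).
have K0 : 0 <= K by rewrite !mulr_ge0// ltW.
have a0 : 0 <= a by rewrite !mulr_ge0.
have aK0 := mulr_ge0 a0 K0.
exists (2 * a * K + 1); first by lra.
exists (Num.bound (2 * K * a)).+1 => q Qq W.
have q_gt0 : 0 < q%:R :> R by rewrite ltr0n (leq_trans _ Qq).
have qK : 2 * K * a <= q%:R.
  have /archi_boundP/ltW/le_trans : 0 <= 2 * K * a by lra.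
  by apply; rewrite ler_nat ltnW.
pose E := W - q%:R *: M.
have Eerr (c : 'rV[R]_d) : enorm (c *m E) <= a * enorm c.
  by apply: enorm_mulmx_le => i j; exact: round_mx_err.
(* [K] and [a] bound the operators [N] and [E]. For [q >= 2 K a] the term coming from [E] is
   absorbed into half of the left-hand side. *)
have key (c : 'rV[R]_d) : q%:R * enorm c <= 2 * K * enorm (c *m W).
  have H1 : enorm (c *m W *m N) <= K * enorm (c *m W) by exact: enorm_mulmx_le.
  have H2 : enorm (c *m E *m N) <= K * enorm (c *m E) by exact: enorm_mulmx_le.
  have H3 : K * enorm (c *m E) <= K * a * enorm c by rewrite -mulrA ler_wpM2l.
  have H4 : 2 * K * a * enorm c <= q%:R * enorm c.
    by rewrite ler_wpM2r ?enorm_ge0.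
  have H5 : q%:R * enorm c = enorm (c *m W *m N - c *m E *m N).
    rewrite -mulmxBl -mulmxBr opprB addrC subrK -scalemxAr -scalemxAl.
    by rewrite -mulmxA MN mulmx1 enormZ ger0_norm.
  have := enormB (c *m W *m N) (c *m E *m N).
  by rewrite -H5; lra.
split=> [|y].
  rewrite -kermx_eq0; apply/rowV0P => c /sub_kermxP cW.
  apply/eqP; rewrite -enorm_eq0 eq_le enorm_ge0 andbT.
  by have := key c; rewrite cW enorm0 mulr0 pmulr_rle0.
rewrite mem_mxspan => /submxP[c ->]; exists (c *m (q%:R *: M)).
  by rewrite mem_mxspan -scalemxAr scalemx_sub// submxMl.
rewrite -mulmxBr (le_trans (Eerr c))// [leRHS]mulrAC ler_pdivlMr//.
apply: (@le_trans _ _ (a * (2 * K * enorm (c *m W)))).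
  by rewrite -[leLHS]mulrA ler_wpM2l// mulrC key.
have := enorm_ge0 (c *m W); nra.
Qed.

Lemma round_mx_minor : exists2 C : R, 0 < C & forall (q : nat) f, (0 < q)%N ->
  `|minor (round_mx (q%:R *: M))%:mxR f| <= C * q%:R ^+ d.
Proof.
have [t t_gt0 Mt] := mx_entry_bound M.
exists (d`!%:R * (t + 1) ^+ d).
  by rewrite mulr_gt0 ?ltr0n ?fact_gt0// exprn_gt0// ltr_pwDr// ltW.
move=> q f q0; rewrite -mulrA -exprMn; apply: det_le => i j.
have q1 : 1 <= q%:R :> R by rewrite ler1n.
have := round_mx_err (q%:R *: M) i (f j); have := Mt i (f j).
rewrite !mxE !ler_norml => /andP[M1 M2] /andP[E1 E2]; apply/andP; split; nra.
Qed.

(** Some row of [M] lies outside [B], so a linear form vanishing on [B] is nonzero there. If [B]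
    contained the rounded row, [q] times this value would be bounded by the rounding error. *)
Lemma round_mx_neq (B : {vspace 'rV[R]_n}) : row_free M -> \dim B = d ->
  B <> mxspan M -> exists Q : nat, forall q : nat, (Q <= q)%N ->
    B <> mxspan (round_mx (q%:R *: M))%:mxR.
Proof.
move=> Mfree dB BM; have [N _ BN] := vspace_mxspan B.
have [i iB] : exists i, row i M \notin B.
  apply: contrapT => /forallNP MB; apply: BM; apply: mxspan_full => // i.
  by apply/negPn/negP; exact: MB.
have {iB} [k ik] : exists k, (row i M *m cokermx N) 0 k != 0.
  apply: contrapT => /forallNP iN; move: iB; rewrite BN mem_mxspan submxE.
  by move=> /negP; apply; apply/eqP/rowP => k; rewrite [RHS]mxE; apply/eqP/negPn/negP/iN.
have [t t_gt0 Nt] := mx_entry_bound (cokermx N).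
exists (Num.bound (n%:R * t / `|(row i M *m cokermx N) 0 k|)).+1 => q Qq BW.
set W := (round_mx _)%:mxR in BW.
have /eqP WN : row i W *m cokermx N == 0.
  rewrite -submxE -mem_mxspan -BN BW mem_mxspan row_sub//.
have {WN}E : q%:R * (row i M *m cokermx N) 0 k =
    - (row i (W - q%:R *: M) *m cokermx N) 0 k.
  by rewrite linearB mulmxBl WN sub0r [in RHS]mxE opprK linearZ -scalemxAl [RHS]mxE.
have := Qq; apply/negP; rewrite -ltnNge ltnS -(ler_nat R).
set r := (n%:R * t / _).
have /archi_boundP/ltW : 0 <= r by rewrite divr_ge0// mulr_ge0// ltW.
apply: le_trans; rewrite {}/r.
rewrite ler_pdivlMr ?normr_gt0// -[X in X * _]ger0_norm// -normrM E normrN mxE.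
rewrite (le_trans (ler_norm_sum _ _ _))// mulr_natl -[X in _ <= _ *+ X]card_ord -sumr_const.
apply: ler_sum => j _; rewrite normrM -[leRHS]mul1r ler_pM// mxE.
exact: round_mx_err.
Qed.

End Approximation.

Lemma powR_nat_unbounded (C g : R) : 0 <= C -> 0 < g ->
  exists Q : nat, forall q : nat, (Q <= q)%N -> C <= q%:R `^ g.
Proof.
move=> C0 g0; exists (Num.bound (C `^ g^-1)) => q Qq.
have -> : C = (C `^ g^-1) `^ g by rewrite -powRrM mulVf ?gt_eqF// powRr1.
apply: ge0_ler_powR; rewrite ?nnegrE ?powR_ge0//; first exact: ltW.
apply: le_trans (ltW (archi_boundP _)) _; first exact: powR_ge0.
by rewrite ler_nat.
Qed.

Lemma exponent_below (d : nat) (C1 C2 b : R) : 0 < C1 -> 0 < C2 -> 0 < b -> b * d%:R < 1 ->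
  exists Q : nat, forall q : nat, (Q <= q)%N -> forall H p : R, 1 <= H ->
    H <= C2 * q%:R ^+ d -> p <= C1 / q%:R -> p <= H `^ (- b).
Proof.
move=> C10 C20 b0 bd.
have [||Q HQ] := @powR_nat_unbounded (C1 * C2 `^ b) (1 - d%:R * b).
- by rewrite mulr_ge0 ?powR_ge0// ltW.
- by rewrite subr_gt0 mulrC.
exists Q.+1 => q Qq H p H1 HC pC; rewrite (le_trans pC)//.
have q0 : 0 < q%:R :> R by rewrite ltr0n (leq_trans _ Qq).
have H0 : 0 < H := lt_le_trans ltr01 H1.
rewrite powRN ler_pdivrMr// mulrC ler_pdivlMr ?powR_gt0//.
have Hb : H `^ b <= (C2 * q%:R ^+ d) `^ b.
  by apply: ge0_ler_powR; rewrite ?nnegrE ?mulr_ge0 ?exprn_ge0// ltW.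
apply: (@le_trans _ _ (C1 * (C2 * q%:R ^+ d) `^ b)); first by rewrite ler_wpM2l// ltW.
rewrite powRM ?exprn_ge0 ?(ltW C20)// -powR_mulrn// -powRrM mulrA.
apply: (@le_trans _ _ (q%:R `^ (1 - d%:R * b) * q%:R `^ (d%:R * b))).
  by rewrite ler_wpM2r ?powR_ge0// HQ// ltnW.
by rewrite -powRD ?subrK ?powRr1 ?oner_eq0//= ltW.
Qed.

Lemma mu_lower n d (A : {vspace 'rV[R]_n}) (b : R) : (0 < d)%N ->
  irrational_subspaces d d d A -> 0 < b -> b * d%:R < 1 ->
  (b%:E <= mu A d d)%E.
Proof.
move=> d_gt0 [Airr dA] b0 bd; apply: ereal_sup_ubound; right; exists b => //; split=> //.
have [M Mfree AM] : exists2 M : 'M[R]_(d, n), row_free M & A = mxspan M.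
  by rewrite -dA; exact: vspace_mxspan.
have [C C0 [Q0 HQ0]] := round_mx_free_dist Mfree.
have [D D0 HD] := round_mx_minor M.
pose N : R := #|{: plucker_index d n}|%:R.
have C2_gt0 : 0 < Num.sqrt (N + 1) * D.
  by rewrite mulr_gt0// sqrtr_gt0 ltr_wpDl.
have C1_gt0 : 0 < 2 ^+ d * C by rewrite mulr_gt0// exprn_gt0.
have [Q1 HQ1] := exponent_below C1_gt0 C2_gt0 b0 bd.
(* Beyond [Q2] the smallness hypothesis of [psi_le] holds. *)
pose Q2 := (Num.bound (2 ^+ d * C)).+1.
pose V q := mxspan (round_mx (q%:R *: M))%:mxR.
(* Each rational [B] differs from [A], by irrationality, hence from [V q] for all [q] past some
   [QB B]. If the set were a finite list [s], a [q] past all thresholds would put [V q] in [s]. *)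
have /choice[QB HQB] : forall B : {vspace 'rV[R]_n}, exists Q : nat,
    rational_subspaces d B -> forall q : nat, (Q <= q)%N -> B <> V q.
  move=> B; have [[Brat dB]|nB] := pselect (rational_subspaces d B); last by exists 0%N.
  have [|Q HQ] := round_mx_neq Mfree dB; last by exists Q.
  move=> BM; have := Airr B (conj Brat dB).
  by rewrite AM BM capvv -AM dA ltnn.
move=> /finite_seqP[s sE].
pose q := maxn (maxn Q0 Q1) (maxn Q2 (\max_(B <- s) QB B)).
have qQ0 : (Q0 <= q)%N by rewrite /q !leq_max leqnn.
have qQ1 : (Q1 <= q)%N by rewrite /q !leq_max leqnn !orbT.
have qQ2 : (Q2 <= q)%N by rewrite /q !leq_max leqnn !orbT.
have qM : (\max_(B <- s) QB B <= q)%N by rewrite /q !leq_max leqnn !orbT.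
have q_gt0 : (0 < q)%N by apply: leq_trans qQ2.
have q0 : 0 < q%:R :> R by rewrite ltr0n.
have [Wfree Wdist] := HQ0 q qQ0; have dV : \dim (V q) = d := dim_mxspan Wfree.
have Vrat : rational_subspaces d (V q) by split=> //; exact: is_rational_mxspan.
have /andP[h1 hle] := height_integral_le dV erefl (fun f => HD q (val f) q_gt0).
have : V q \in s.
  suff : [set` s] (V q) by [].
  rewrite -sE; split=> //; apply: (HQ1 q qQ1) => //.
    apply: le_trans hle _; rewrite sqrtrM// sqrtr_sqr ger0_norm; last first.
      by rewrite mulr_ge0 ?exprn_ge0// ltW.
    rewrite -[leRHS]mulrA ler_wpM2r ?mulr_ge0 ?exprn_ge0 ?(ltW D0)//.
    by rewrite ler_wsqrtr// lerDl.
  rewrite -mulrA; apply: psi_le => //; rewrite ?dA ?dV//.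
    by rewrite AM.
  rewrite mulrA ltr_pdivrMr// mul1r.
  apply: lt_le_trans (archi_boundP (ltW C1_gt0)) _.
  by rewrite ler_nat (leq_trans _ qQ2).
move=> Vs; apply: (HQB (V q) Vrat q) => //.
by apply: leq_trans qM; rewrite (big_rem _ Vs) /= leq_maxl.
Qed.

End LowerBound.

(** * Totally real polynomials *)

Section TotallyRealPolynomial.

(* Eisenstein at 2, with the roots 4 i perturbed so little that the values at the
   points 4 k - 2 still alternate in sign. *)
Definition eisenstein_poly (n : nat) : {poly int} :=
  \prod_(i < n) ('X - (4 * i%:Z)%:P) + 2%:P.

Lemma size_eisenstein_poly n : (0 < n)%N -> size (eisenstein_poly n) = n.+1.
Proof.
move=> n0; rewrite size_polyDl size_prod_XsubC /index_enum -enumT size_enum_ord//.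
by rewrite (leq_ltn_trans (size_polyC_leq1 _)).
Qed.

Lemma eisenstein_poly_monic n : (0 < n)%N -> eisenstein_poly n \is monic.
Proof.
move=> n0; rewrite monicE lead_coefDl ?(monicP (monic_prod_XsubC _ _ _))//.
rewrite size_prod_XsubC /index_enum -enumT size_enum_ord.
by rewrite (leq_ltn_trans (size_polyC_leq1 _)).
Qed.

Lemma eisenstein_poly_irreducible n : (0 < n)%N -> irreducible_poly (eisenstein_poly n).
Proof.
move=> n0; have sz := size_eisenstein_poly n0.
apply: (@eisenstein_crit 2) => //.
- by rewrite sz; case: n n0 sz.
- by rewrite (monicP (eisenstein_poly_monic n0)).
(* The factor with [i = 0] is ['X], so the constant coefficient is 2, which 4 does not divide. *)
- rewrite coefD coefC /= -horner_coef0 horner_prod (bigD1 (Ordinal n0))//=.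
  by rewrite !hornerE /=.
move=> i; rewrite sz /= => ni; rewrite (dvdz_pcharf (pchar_Fp (isT : prime 2))).
rewrite -coef_map rmorphD rmorph_prod /= map_polyC /=.
under eq_bigr do rewrite map_polyXsubC /= intrM.
have -> : 2%:~R = 0 :> 'F_2 by apply/val_inj.
have -> : 4%:~R = 0 :> 'F_2 by apply/val_inj.
under eq_bigr do rewrite mul0r polyC0 subr0.
by rewrite polyC0 addr0 prodr_const card_ord coefXn ltn_eqF.
Qed.

Context {R : realType} {n : nat} (n_gt1 : (1 < n)%N).

Local Notation f := (map_poly (intr : int -> R) (eisenstein_poly n)).
Local Notation t k := (4 * k%:R - 2 : R).

(** Every factor of [g] has absolute value at least 2 at these points, so [g] is at least
    [2 ^+ n >= 4] there and adding 2 keeps its sign. Between two consecutive points only the factor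
    of index [k] changes sign. *)
Lemma eisenstein_poly_sign_change k : (k < n)%N ->
  f.[t k] * f.[t k.+1] < 0.
Proof.
move=> kn; pose g (x : R) := \prod_(i < n) (x - 4 * i%:R).
have fE x : f.[x] = g x + 2.
  rewrite rmorphD rmorph_prod /= map_polyC /= hornerD hornerC horner_prod.
  by congr (_ + _); apply: eq_bigr => i _; rewrite map_polyXsubC /= !hornerE intrM.
have g_ge j : 4 <= `|g (t j)|.
  apply: (@le_trans _ _ (\prod_(i < n) 2)).
    rewrite prodr_const card_ord -(subnKC n_gt1) exprD -natrX -[leLHS]mulr1 ler_wpM2l//.
    by rewrite exprn_ege1// ler1n.
  rewrite normr_prod; apply: ler_prod => i _; rewrite ler0n /=.
  have [ji|ij] := leqP j i.
    have ji' : (j%:R : R) <= i%:R by rewrite ler_nat.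
    by rewrite ler0_norm; lra.
  have ij' : (i.+1%:R : R) <= j%:R by rewrite ler_nat.
  by rewrite -natr1 in ij'; rewrite ger0_norm; lra.
have gg : g (t k) * g (t k.+1) < 0.
  rewrite -big_split (bigD1 (Ordinal kn))//= pmulr_llt0.
    by rewrite -natr1; nra.
  apply: prodr_gt0 => i ik; rewrite -natr1.
  have /orP[ik1|ki1] : (i < k)%N || (k < i)%N by rewrite -neq_ltn -val_eqE /= in ik *.
    have : (i.+1%:R : R) <= k%:R by rewrite ler_nat.
    by rewrite -natr1; nra.
  have : (k.+1%:R : R) <= i%:R by rewrite ler_nat.
  by rewrite -natr1; nra.
have := g_ge k; have := g_ge k.+1; rewrite !fE => G1 G2.
case: (ltrP (g (t k)) 0) G2 => s1; case: (ltrP (g (t k.+1)) 0) G1 => s2.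
- by move: gg; rewrite ltNge mulr_le0// ltW.
- by rewrite (ger0_norm s2) (ltr0_norm s1) => G1 G2; rewrite nmulr_rlt0; lra.
- by rewrite (ltr0_norm s2) (ger0_norm s1) => G1 G2; rewrite pmulr_rlt0; lra.
- by move: gg; rewrite ltNge mulr_ge0.
Qed.

(** The inequalities are strict, so that roots from adjacent intervals are distinct. *)
Lemma ivt_sign_change (p : {poly R}) (a b : R) : a < b -> p.[a] * p.[b] < 0 ->
  exists x, a < x < b /\ root p x.
Proof.
move=> ab pab; wlog pa : p pab / p.[a] < 0 => [H|].
  case: (ltrP p.[a] 0) => [|pa]; first exact: H.
  have [||x [xab px]] := H (- p); rewrite ?hornerN ?mulrNN//.
    rewrite oppr_lt0 lt_def pa andbT.
    by apply: contraTneq pab => ->; rewrite mul0r ltxx.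
  by exists x; rewrite -rootN.
have pb : 0 < p.[b] by move: pab; rewrite nmulr_rlt0.
have [|x xab px] := @poly_ivt _ p a b (ltW ab); first by rewrite !ltW.
exists x; split=> //; move: xab => /andP[ax xb]; rewrite !lt_def ax xb !andbT.
apply/andP; split; apply: contraTneq px => E; rewrite rootE.
  by rewrite E lt_eqF.
by rewrite -E gt_eqF.
Qed.

Lemma eisenstein_poly_roots : exists2 al : 'I_n -> R, injective al &
  forall k, root f (al k).
Proof.
have /choice[al Hal] : forall k : 'I_n, exists x, t k < x < t k.+1 /\ root f x.
  move=> k; apply: ivt_sign_change; first by rewrite -natr1; lra.
  exact: eisenstein_poly_sign_change.
exists al => [k l|k]; last by have [] := Hal k.
have lt_al (i j : 'I_n) : (i < j)%N -> al i < al j.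
  move=> ij; have [/andP[_ a1] _] := Hal i; have [/andP[a2 _] _] := Hal j.
  apply: lt_trans a2; apply: lt_le_trans a1 _.
  by have : (i.+1%:R : R) <= j%:R; [rewrite ler_nat|lra].
by move=> E; apply: val_inj; case: (ssrnat.ltngtP k l) => // /lt_al; rewrite E ltxx.
Qed.

End TotallyRealPolynomial.

(** * Norms of integral polynomials modulo [f] *)

Section Norm.
Context {R : realType} {n : nat} (f : {poly int}) (al : 'I_n -> R)
  (f_monic : f \is monic) (f_irr : irreducible_poly f)
  (f_size : size f = n.+1) (al_inj : injective al)
  (f_al : forall k, root (map_poly intr f) (al k)).

(** Right multiplication by it sends coefficients to the values at the conjugates. *)
Definition vander : 'M[R]_n := Vandermonde n (\row_k al k).

Lemma vander_unit : vander \in unitmx.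
Proof.
rewrite unitmxE unitfE det_Vandermonde; apply/prodf_neq0 => i _.
apply/prodf_neq0 => j ij; rewrite !mxE subr_eq0; apply: contraTneq ij => /al_inj ->.
by rewrite ltnn.
Qed.

Lemma mul_vander (x : 'rV[int]_n) k :
  (map_mx intr x *m vander) 0 k = (map_poly intr (rVpoly x)).[al k].
Proof.
rewrite map_rVpoly /rVpoly horner_poly mxE; apply: eq_bigr => i _.
by rewrite !mxE; case: insubP => [j _ /val_inj -> |]; rewrite ?mxE// ltn_ord.
Qed.

(* The product of the conjugates of an element of Z[X]/f is the determinant of
   the multiplication by this element. *)
Lemma conjugates_prod_ge1 (x : 'rV[int]_n) : x != 0 ->
  1 <= \prod_k `|(map_mx intr x *m vander) 0 k|.
Proof.
move=> x0; pose P := rVpoly x.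
have P0 : P != 0.
  by apply: contra_neq x0 => P0; rewrite -[x]rVpolyK -/P P0 linear0.
(* Multiplication by [P] modulo [f] in the basis of powers of ['X]. Evaluating at the roots of [f]
   shows that [vander] diagonalizes it. *)
pose K : 'M[int]_n := \matrix_(i, j) (Pdiv.CommonRing.rmodp ('X^i * P) f)`_j.
have f0 : f != 0 by rewrite monic_neq0.
have KV : map_mx intr K *m vander =
    vander *m diag_mx (map_mx intr x *m vander).
  apply/matrixP => i k; rewrite mul_mx_diag [RHS]mxE mul_vander -/P.
  rewrite [X in X * _]mxE mxE [X in _ = X ^+ _ * _]mxE.
  have : map_poly (intr : int -> R) ('X^i * P) =
      map_poly intr (Pdiv.CommonRing.rdivp ('X^i * P) f) * map_poly intr f +
      map_poly intr (Pdiv.CommonRing.rmodp ('X^i * P) f).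
    by rewrite {1}(Pdiv.RingMonic.rdivp_eq f_monic ('X^i * P)) rmorphD rmorphM.
  move=> /(congr1 (fun p => p.[al k])); rewrite rmorphM /= map_polyXn.
  rewrite !hornerE /= (eqP (f_al k)) mulr0 add0r => ->.
  rewrite (@horner_coef_wide _ n); last first.
    apply: leq_trans (size_poly _ _) _.
    by rewrite -ltnS -f_size Pdiv.CommonRing.ltn_rmodpN0.
  by apply: eq_bigr => j _; rewrite !mxE coef_map.
have detK : (\det K)%:~R = \prod_k (map_mx intr x *m vander) 0 k :> R.
  have := congr1 determinant KV; rewrite !det_mulmx det_diag mulrC -det_map_mx.
  by apply: mulfI; rewrite -unitfE -unitmxE vander_unit.
rewrite -normr_prod -detK -intr_norm ler1z -gtz0_ge1 normr_gt0.
rewrite -(intr_eq0 R) detK; apply/prodf_neq0 => k _; rewrite mul_vander -/P.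
(* [P] has degree less than [n], so it is coprime to the irreducible [f]; a Bezout relation
   evaluated at a common root would make a nonzero constant vanish. *)
have /Bezout_coprimepP[[u v] /= /eqpP[[c1 c2] /= /andP[c10 c20] uv]] : coprimep f P.
  rewrite (irreducible_poly_coprime _ f_irr); apply/negP => /(dvdp_leq P0).
  by rewrite f_size leqNgt ltnS size_poly.
apply/eqP => Pal; have := congr1 (fun p => (map_poly (intr : int -> R) p).[al k]) uv.
rewrite !map_polyZ rmorphD !rmorphM rmorph1 /= !hornerE Pal (eqP (f_al k)).
rewrite !mulr0 addr0 mulr0 ?mulr1 => /esym/eqP; rewrite intr_eq0.
by move: c20 => /negPf ->.
Qed.

End Norm.

(** * Upper bound *)

Section UpperBound.
Context {R : realType}.

Local Notation "W %:mxR" := (map_mx (intr : int -> R) W) (at level 2, format "W %:mxR").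

Lemma prod_if_ltn (n d : nat) (a b : R) : (d <= n)%N ->
  \prod_(k < n) (if (k < d)%N then a else b) = a ^+ d * b ^+ (n - d).
Proof.
move=> dn; rewrite -(big_mkord xpredT (fun k => if (k < d)%N then a else b)).
rewrite (@big_cat_nat _ _ _ d)//=; congr (_ * _).
  under eq_big_nat => i /andP[_ ->] do over.
  by rewrite prodr_const_nat subn0.
under eq_big_nat => i /andP[di _] do rewrite ltnNge di /=.
by rewrite prodr_const_nat.
Qed.

Lemma badly_approximable_subspace (n d : nat) : (1 < n)%N -> (d <= n)%N ->
  exists A : {vspace 'rV[R]_n}, \dim A = d /\
    exists2 C : R, 0 < C & forall (x : 'rV[int]_n) a, x != 0 -> a \in A ->
      1 <= C * enorm x%:mxR ^+ d * enorm (x%:mxR - a) ^+ (n - d).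
Proof.
move=> n1 dn; have n0 : (0 < n)%N := ltnW n1.
have [al al_inj al_root] := @eisenstein_poly_roots R n n1.
pose V := vander al; have Vu : V \in unitmx := vander_unit al_inj.
(* The first [d] rows of the inverse of [V]: their span consists of the [a] whose product [a *m V]
   vanishes at indices from [d] on. *)
pose M : 'M[R]_(d, n) := pid_mx d *m invmx V.
have Mfree : row_free M.
  apply/row_freeP; exists (V *m pid_mx d).
  rewrite /M mulmxA mulmxKV// mul_pid_mx -pid_mx_1; congr pid_mx.
  by rewrite minnn (minn_idPr dn).
exists (mxspan M); split; first exact: dim_mxspan.
have [t t0 Vt] := mx_entry_bound V.
pose K : R := n%:R * t; have K0 : 0 < K by rewrite mulr_gt0// ltr0n.
have VK (y : 'rV[R]_n) k : `|(y *m V) 0 k| <= K * enorm y.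
  rewrite mxE (le_trans (ler_norm_sum _ _ _))// /K -mulrA.
  apply: (@le_trans _ _ (\sum_(i < n) t * enorm y)).
    apply: ler_sum => i _; rewrite normrM mulrC ler_pM//; exact: coord_le_enorm.
  by rewrite sumr_const card_ord mulr_natl.
exists (K ^+ n) => [|x a x0]; first exact: exprn_gt0.
rewrite mem_mxspan => /submxP[c aE].
have aV (k : 'I_n) : (d <= k)%N -> (a *m V) 0 k = 0.
  move=> dk; rewrite aE /M -mulmxA mulmxKV// mxE big1// => i _.
  by rewrite mxE (ltn_eqF (leq_trans (ltn_ord i) dk)) mulr0.
apply: le_trans (conjugates_prod_ge1 (eisenstein_poly_monic n0)
  (eisenstein_poly_irreducible n0) (size_eisenstein_poly n0) al_inj al_root x0) _.
have -> : K ^+ n = K ^+ d * K ^+ (n - d) by rewrite -exprD subnKC.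
(* The first [d] conjugates are bounded through [x], the other [n - d] through [x - a], as [a] does
   not contribute to them. *)
rewrite -/V -[leRHS]mulrA mulrACA -!exprMn -prod_if_ltn//.
apply: ler_prod => k _; rewrite normr_ge0 /=; case: ltnP => dk; first exact: VK.
have -> : (x%:mxR *m V) 0 k = ((x%:mxR - a) *m V) 0 k.
  by rewrite mulmxBl [RHS]mxE [X in _ = _ + X]mxE aV// subr0.
exact: VK.
Qed.

Lemma badly_approximable_mu (n d : nat) (A : {vspace 'rV[R]_n}) (C : R) :
  (0 < d)%N -> (d < n)%N -> \dim A = d -> 0 < C ->
  (forall (x : 'rV[int]_n) a, x != 0 -> a \in A ->
      1 <= C * enorm x%:mxR ^+ d * enorm (x%:mxR - a) ^+ (n - d)) ->
  irrational_subspaces d d d A /\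
  (mu A d d <= (n%:R / (d%:R * (n - d)%:R))%:E)%E.
Proof.
move=> d0 dn dA C0 HA; split.
  split=> // B [ratB dB]; rewrite ltnNge; apply/negP => dAB.
  have [|x [x0 xB _]] := rational_short_vector ratB; first by rewrite dB.
  (* Otherwise [B] lies in [A], and the choice [a = x] gives [1 <= 0], as [n - d] is positive. *)
  have BA : (B <= A)%VS.
    suff /eqP <- : (A :&: B == B)%VS by exact: capvSl.
    by rewrite eqEdim capvSr dB.
  have := HA x _ x0 (subvP BA _ xB); rewrite subrr enorm0 expr0n.
  by rewrite subn_eq0 leqNgt dn /= mulr0 ler10.
have dR : 0 < d%:R :> R by rewrite ltr0n.
have ndR : 0 < (n - d)%:R :> R by rewrite ltr0n subn_gt0.
apply: ge_ereal_sup => _ [->|[b [b0 binf] <-]].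
  by rewrite lee_fin divr_ge0// mulr_ge0// ltW.
rewrite lee_fin leNgt; apply/negP => bgt; apply: binf.
(* With [|x| = O(H^(1/d))] and [|x - a| = O(H^(1/d - b))], the product [|x|^d |x - a|^(n - d)] is
   [O(H^(- g))]; [D] collects the constants, and [g > 0] bounds [H]. *)
pose g := b * (n - d)%:R - n%:R / d%:R.
have g0 : 0 < g.
  rewrite subr_gt0 ltr_pdivrMr//; move: bgt.
  by rewrite ltr_pdivrMr ?mulr_gt0// [d%:R * _]mulrC mulrA.
pose D : R := C * (n%:R * d%:R) ^+ d * (d%:R * (n%:R * d%:R)) ^+ (n - d).
apply: (sub_finite_set _ (@northcott R n d (D `^ g^-1))).
move=> B [[ratB dB] psiB]; split=> //.
have [Xi XiB] := rational_primitive ratB; have H1 := height_ge1 XiB.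
have Hgt0 : 0 < height B := lt_le_trans ltr01 H1.
have [|x [x0 xB xle]] := rational_short_vector ratB; first by rewrite dB.
rewrite dB in xle; set h := height B `^ d%:R^-1.
have hd : h ^+ d = height B.
  by rewrite -powR_mulrn ?powR_ge0// -powRrM mulVf ?gt_eqF// powRr1// ltW.
have h_gt0 : 0 < h by exact: powR_gt0.
have xh : enorm x%:mxR <= n%:R * d%:R * h.
  rewrite -mulrA; apply: enorm_le => k.
  rewrite -(@ler_pXn2r _ d) ?nnegrE ?mulr_ge0 ?(ltW h_gt0)//.
  by rewrite exprMn hd.
have [a aA xa] := @psi_approx _ _ A B _ (etrans dA (esym dB)) xB.
have {}xa : enorm (x%:mxR - a) <= d%:R * (n%:R * d%:R) * (h * height B `^ (- b)).
  apply: le_trans xa _; rewrite dB.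
  rewrite (_ : _ * (h * _) = d%:R * height B `^ (- b) * (n%:R * d%:R * h)); last by ring.
  apply: ler_pM; rewrite ?enorm_ge0 ?mulr_ge0 ?psi_ge0// ler_wpM2l//.
have key : 1 <= D * height B `^ (- g).
  apply: le_trans (HA x a x0 aA) _.
  have -> : height B `^ (- g) = h ^+ d * (h * height B `^ (- b)) ^+ (n - d).
    rewrite exprMn mulrA -exprD subnKC ?(ltnW dn)// /h.
    rewrite -!powR_mulrn ?powR_ge0// -!powRrM -powRD ?(gt_eqF Hgt0) ?implybT//.
    by congr (_ `^ _); rewrite /g; field; rewrite gt_eqF.

  have -> : D * (h ^+ d * (h * height B `^ (- b)) ^+ (n - d)) = C *
      (n%:R * d%:R * h) ^+ d *
      (d%:R * (n%:R * d%:R) * (h * height B `^ (- b))) ^+ (n - d).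
    rewrite [(_ * h) ^+ d]exprMn [(_ * (h * _)) ^+ _]exprMn /D.
    by rewrite mulrACA [C * (_ * h ^+ d)]mulrA.
  have nd0 : 0 <= n%:R * d%:R :> R by rewrite mulr_ge0.
  apply: ler_pM; rewrite ?exprn_ge0 ?mulr_ge0 ?exprn_ge0 ?enorm_ge0 ?(ltW C0)//.
    by rewrite ler_wpM2l ?(ltW C0)// lerXn2r ?nnegrE ?enorm_ge0 ?mulr_ge0 ?(ltW h_gt0).
  by rewrite lerXn2r ?nnegrE ?enorm_ge0 ?mulr_ge0 ?powR_ge0 ?(ltW h_gt0).
have HD : height B `^ g <= D by move: key; rewrite powRN ler_pdivlMr ?mul1r ?powR_gt0.
have -> : height B = (height B `^ g) `^ g^-1.
  by rewrite -powRrM mulfV ?gt_eqF// powRr1// ltW.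
by apply: ge0_ler_powR; rewrite ?invr_ge0 ?nnegrE ?powR_ge0 ?(ltW g0)// (le_trans _ HD) ?powR_ge0.
Qed.

Lemma mu_circ_upper (n d : nat) : (0 < d)%N -> (d < n)%N -> (1 < n)%N ->
  (mu_circ R n d d d <= (n%:R / (d%:R * (n - d)%:R))%:E)%E.
Proof.
move=> d0 dn n1; have [A [dA [C C0 HA]]] := badly_approximable_subspace n1 (ltnW dn).
have [Airr muA] := badly_approximable_mu d0 dn dA C0 HA.
by apply: le_trans muA; apply: ereal_inf_lbound; exists A.
Qed.

Lemma mu_circ_lower (n d : nat) : (0 < d)%N ->
  ((1 / d%:R)%:E <= mu_circ R n d d d)%E.
Proof.
move=> d0; have dR : 0 < d%:R :> R by rewrite ltr0n.
apply: le_ereal_inf_tmp => _ [A Airr <-]; rewrite leNgt; apply/negP => muA.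
have mu0 : (0 <= mu A d d)%E by apply: ereal_sup_ubound; left.
move: mu0 muA (fun b => @mu_lower R n d A b d0 Airr).
case: (mu A d d) => [r| |]//; rewrite !lee_fin !lte_fin => r0 rd.
(* The midpoint of [mu A] and [1 / d] is an exponent below [1 / d] that [mu A] fails to reach. *)
have bP : 0 < (r + 1 / d%:R) / 2 by rewrite divr_gt0// ltr_wpDl// divr_gt0.
have bd : (r + 1 / d%:R) / 2 * d%:R < 1.
  rewrite -ltr_pdivlMr// ; lra.
move=> /(_ _ bP bd); rewrite lee_fin; lra.
Qed.

End UpperBound.

Theorem corollary1p1 (R : realType) (d : nat) (hd : (1 <= d)%N) :
  mu_circ R n d d d @[n --> \oo] --> (1 / d%:R)%:E.
Proof.
(* This is the partial fraction form of [n / (d (n - d))]. *)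
pose u (n : nat) : R := 1 / d%:R + (n - d)%:R^-1.
have bounds : \forall n \near \oo,
    ((1 / d%:R)%:E <= mu_circ R n d d d <= (u n)%:E)%E.
  near=> n; have dn : (d < n)%N by near: n; exact: nbhs_infty_gt.
  rewrite mu_circ_lower//=; apply: le_trans (mu_circ_upper hd dn (leq_ltn_trans hd dn)) _.
  rewrite lee_fin /u natrB ?(ltnW dn)// le_eqVlt; apply/orP; left; apply/eqP.
  have nd : n%:R - d%:R != 0 :> R by rewrite subr_eq0 eqr_nat gtn_eqF.
  by field; rewrite nd pnatr_eq0 -lt0n hd.
apply: (squeeze_cvge bounds); first exact: cvg_cst.
apply: cvg_EFin; first by near=> n.
have -> : 1 / d%:R = 1 / d%:R + 0 :> R by rewrite addr0.
(* After a shift by [d.+1], the inverse of [n - d] becomes the harmonic sequence. *)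
rewrite -(cvg_shiftn d.+1); apply: cvgD; first exact: cvg_cst.
apply: cvg_trans cvg_harmonic; apply: near_eq_cvg; near=> n.
by rewrite /= addnS subSn ?leq_addl// addnK.
Unshelve. all: end_near.
Qed.
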